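(* Let $G$ be an outerplanar graph with finite girth $g\ge 5$ and let $a\ge b\ge 1$ be integers. Then \[\mathsf{fsep}(C_{g-1},a,b)\le \mathsf{fsep}(G,a,b)\le \mathsf{fsep}(C_g,a,b),\] where $C_m$ denotes the cycle on $m$ vertices.
   Context: All graphs are finite and simple. An outerplanar graph is a graph having a planar drawing in which all vertices lie on the outer face. The girth is the length of a shortest cycle (finite girth means the graph contains a cycle). For integers $a\ge b\ge 1$ and $c\ge 0$: an $a$-list assignment of a graph $G$ is a function $L$ assigning to each vertex $v$ a set $L(v)$ of exactly $a$ integers (colors). It is $c$-separating if $|L(u)\cap L(v)|\le c$ for every edge $uv$. An $(L,b)$-coloring of $G$ is a function $\varphi$ assigning to each vertex $v$ a set $\varphi(v)\subseteq L(v)$ with $|\varphi(v)|=b$ such that $\varphi(u)\cap\varphi(v)=\emptyset$ for every edge $uv$. $G$ is $(a,b,c)$-free-choosable if for every $c$-separating $a$-list assignment $L$ of $G$, every vertex $v$ and every $C\subseteq L(v)$ with $|C|=b$, there exists an $(L,b)$-coloring $\varphi$ of $G$ with $\varphi(v)=C$. The free-separation number is $\mathsf{fsep}(G,a,b)=\max\{c\ge 0: G\text{ is }(a,b,c)\text{-free-choosable}\}$. *)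

(* Defs.v *)
From mathcomp Require Import all_boot all_order all_algebra finmap.
From mathcomp Require Import all_classical all_reals all_analysis.

Set Implicit Arguments.
Unset Strict Implicit.
Unset Printing Implicit Defensive.

Import Order.TTheory GRing.Theory Num.Theory numFieldNormedType.Exports.

Local Open Scope ring_scope.
Local Open Scope classical_set_scope.

Record sgraph := SGraph {
  vertex :> finType;
  edge : rel vertex;
  edge_sym : symmetric edge;
  edge_irr : irreflexive edge }.

(* [ucycle] also accepts the closed walk x, y, x along a single edge; the bound
   on [size s] rules it out. *)
Definition has_cycle (G : sgraph) (k : nat) : Prop :=
  exists s : seq G, [/\ ucycle (@edge G) s, size s = k & (3 <= size s)%N].

Definition is_girth (G : sgraph) (g : nat) : Prop :=
  has_cycle G g /\ forall k, has_cycle G k -> (g <= k)%N.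

(* [ordS i] is i + 1 mod m, so this is the cycle C_m as soon as 3 <= m. *)
Definition cycle_rel (m : nat) : rel 'I_m :=
  [rel i j | (i != j) && ((j == ordS i) || (i == ordS j))].

Lemma cycle_rel_sym m : symmetric (@cycle_rel m).
Proof. by move=> i j; rewrite /cycle_rel /= eq_sym orbC. Qed.

Lemma cycle_rel_irr m : irreflexive (@cycle_rel m).
Proof. by move=> i; rewrite /cycle_rel /= eqxx. Qed.

Definition cycle_graph (m : nat) : sgraph :=
  SGraph (@cycle_rel_sym m) (@cycle_rel_irr m).

(* Edges are oriented only for parametrization: [arc u v] and [arc v u] run
   along the same arc in opposite directions, and [arc u v] is meaningful only
   on [0, 1] and for adjacent u and v. *)
Record plane_drawing (R : realType) (G : sgraph) := PlaneDrawing {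
  pos : G -> R * R;
  arc : G -> G -> R -> R * R;
  pos_inj : injective pos;
  arc_continuous : forall u v, edge u v ->
    {within `[0, 1], continuous (arc u v)};
  arc_inj : forall u v, edge u v -> {in `[0, 1] &, injective (arc u v)};
  arc_rev : forall u v, edge u v ->
    {in `[0, 1], forall t, arc v u t = arc u v (1 - t)};
  arc0 : forall u v, edge u v -> arc u v 0 = pos u;
  arc1 : forall u v, edge u v -> arc u v 1 = pos v;
  arc_vertex : forall u v w, edge u v ->
    {in `]0, 1[, forall t, arc u v t <> pos w};
  arc_cross : forall u v u' v', edge u v -> edge u' v' ->
    {in `]0, 1[ &, forall s t, arc u v s = arc u' v' t ->
      (u = u' /\ v = v') \/ (u = v' /\ v = u')} }.

Definition drawn_points (R : realType) (G : sgraph) (D : plane_drawing R G) :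
    set (R * R) :=
  [set p | (exists v, p = pos D v) \/
           (exists u v, edge u v /\ (arc D u v @` `[0, 1]) p)].

(* The union of the unbounded components of the complement of D; there is
   exactly one such component because the drawn points form a compact set.
   [connected_component A x] is empty when x is not in A. *)
Definition outer_face (R : realType) (G : sgraph) (D : plane_drawing R G) :
    set (R * R) :=
  [set x | ~ bounded_set (connected_component (~` drawn_points D) x)].

Definition outerplanar (R : realType) (G : sgraph) : Prop :=
  exists D : plane_drawing R G, forall v, closure (outer_face D) (pos D v).

Definition list_assignment (G : sgraph) (a : nat) (L : G -> {fset int}) : Prop :=
  forall v, #|` L v| = a.

Definition separating (G : sgraph) (c : nat) (L : G -> {fset int}) : Prop :=
  forall u v, edge u v -> (#|` (L u `&` L v)%fset| <= c)%N.

Definition list_coloring (G : sgraph) (L : G -> {fset int}) (b : nat)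
    (phi : G -> {fset int}) : Prop :=
  (forall v, (phi v `<=` L v)%fset /\ #|` phi v| = b) /\
  (forall u v, edge u v -> (phi u `&` phi v = fset0)%fset).

Definition free_choosable (G : sgraph) (a b c : nat) : Prop :=
  forall L : G -> {fset int}, list_assignment a L -> separating c L ->
  forall (v : G) (C : {fset int}), (C `<=` L v)%fset -> #|` C| = b ->
  exists phi : G -> {fset int}, list_coloring L b phi /\ phi v = C.

(* The supremum is taken in the extended reals because the set can be all of
   nat: for c >= a being c-separating is no restriction, so a graph that is
   (a, b, a)-free-choosable has no largest c, and its fsep is +oo. In all other
   cases, when a >= b, the set is nonempty (it contains 0) and bounded by a, and
   the supremum is its maximum. *)
Definition fsep (R : realType) (G : sgraph) (a b : nat) : \bar R :=
  ereal_sup [set c%:R%:E | c in [set c : nat | free_choosable G a b c]].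

(* Main.v *)
(** Both inequalities are inclusions between sets of admissible c.

Upper bound: a shortest cycle of G is chordless, so a list assignment of C_g
extends to G by giving fresh, pairwise disjoint lists to all other vertices.

Lower bound: suppose C_{g-1} is (a,b,c)-free-choosable. Then any path with at
least g-2 vertices, each end of which also has one precoloured outer neighbour,
can be coloured: the colours forbidden at the two ends may be renamed into fresh
ones, so they can be taken from one common set C, and closing the path with a
vertex coloured C gives a cycle (longer paths are shortened greedily). In a graph
of girth g >= 5 in which no two vertices are joined by three disjoint connected
blocks (no K_{2,3}), a minimal vertex set D avoiding v whose outside neighbours
form at most a vertex or an edge is either a vertex of degree at most 1 or the
interior of such a path of degree-2 vertices, so G is coloured by induction.

An outerplanar drawing contains no K_{2,3}: joining a point of the outer face to
the three vertices of degree 2 would draw K_{3,3} with disjoint independent edges.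
That is excluded without the Jordan curve theorem. Curves are replaced by fine
chains of points; for two chains e, f that stay far apart the map
(s, t) |-> e(s) - f(t) has winding number 0 around the boundary of its domain.
Modulo 2 this is a relation between the numbers n(v, e) of crossings of e with the
horizontal ray from v, and the relations of the 18 pairs of independent edges of
K_{3,3} add up to 1 = 0. *)

Require Import Defs.
From mathcomp Require Import all_boot all_order all_algebra.
From mathcomp Require Import all_classical all_reals all_analysis.
From mathcomp Require Import finmap ring lra zify.
From Stdlib Require Import Btauto.

Set Implicit Arguments.
Unset Strict Implicit.
Unset Printing Implicit Defensive.
Import Order.TTheory GRing.Theory Num.Theory numFieldNormedType.Exports.

(** * Parity of crossings *)

Section K33Parity.
Local Open Scope nat_scope.

Lemma addb_xorb b c : b (+) c = xorb b c.
Proof. by case: b; case: c. Qed.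

(* [n i' i j] is n(v, e) for v = a_i' and e = a_i b_j, and [m j' i j] the same for
   v = b_j'. In the sum of all relations every term cancels, except that
   [z j j'] meets [z j' j] three times for each of the three pairs {j, j'}. *)
Lemma K33_parity (n m : nat -> nat -> nat -> bool) (u : nat -> nat -> bool)
   (v w z: nat -> nat -> bool) :
  (forall i j i' j', i < i' -> i' < 3 -> j < 3 -> j' < 3 -> j != j' ->
    n i' i j (+) m j' i j (+) (n i i' j' (+) m j i' j') (+)
    (u i i' (+) v i j' (+) (w i' j (+) z j j')) = false) ->
  (forall j j', j < j' -> j' < 3 -> z j' j = ~~ z j j') -> False.
Proof.
move=> E Z.
pose X i j i' j' := n i' i j (+) m j' i j (+) (n i i' j' (+) m j i' j') (+)
    (u i i' (+) v i j' (+) (w i' j (+) z j j')).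
(* [T i i'] runs over the six ordered pairs of distinct columns, so the three instances below use
   each of the 18 pairs of independent edges once. *)
pose T i i' := X i 0 i' 1 (+) X i 0 i' 2 (+) X i 1 i' 0 (+) X i 1 i' 2 (+) X i 2 i' 0 (+)
  X i 2 i' 1.
have : T 0 1 (+) T 0 2 (+) T 1 2 = false by rewrite /T /X !E.
suff -> : T 0 1 (+) T 0 2 (+) T 1 2 = true by [].
rewrite /T /X (Z 0 1)// (Z 0 2)// (Z 1 2)// !addb_xorb.
btauto.
Qed.

End K33Parity.

(** * Crossings of chains with a half-axis, modulo 2 *)

Section Parity.
Context {R : realType}.
Local Open Scope ring_scope.
Implicit Types (p q v w x y : R * R) (s t : seq (R * R)) (d : R).

(* The horizontal axis is split so that [upper (- p) = ~~ upper p] for p != 0. *)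
Definition upper p : bool := (0 < p.2) || (p.2 == 0) && (0 < p.1).

(* The step from p to q crosses the positive horizontal half-axis; meaningful only
   for steps that are short compared with the distance to the origin. *)
Definition cross p q : bool := (0 < p.1) && (upper p (+) upper q).

Fixpoint crossings (f : R * R -> R * R) x s : bool :=
  if s is y :: s' then cross (f x) (f y) (+) crossings f y s' else false.

Lemma upperN p : p != 0 -> upper (- p) = ~~ upper p.
Proof.
case: p => p1 p2; rewrite /upper /= xpair_eqE !oppr_gt0 oppr_eq0 /= => p0.
case: (ltrgtP p2 0) p0 => //= _; case: (ltrgtP p1 0) => //=.
Qed.

(** Away from the origin, a short step that changes half-plane meets exactly one of the two
    horizontal half-axes, and negation exchanges these. *)
Lemma cross_neg d p q : `|p.2 - q.2| < d ->
  (3%:R * d <= `|p.1|) || (3%:R * d <= `|p.2|) ->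
  (3%:R * d <= `|q.1|) || (3%:R * d <= `|q.2|) ->
  cross (- p) (- q) = cross p q (+) (upper p (+) upper q).
Proof.
case: p => p1 p2; case: q => q1 q2 /= dpq fp fq.
have d0 : 0 < d by apply: le_lt_trans dpq.
have p0 : (p1, p2) != 0 :> R * R.
  apply/eqP => -[p10 p20]; move: fp; rewrite p10 p20 normr0 orbb; lra.
have q0 : (q1, q2) != 0 :> R * R.
  apply/eqP => -[p10 p20]; move: fq; rewrite p10 p20 normr0 orbb; lra.
rewrite /cross !upperN// addbN addNb negbK /= oppr_gt0.
have [->|nU] := eqVneq (upper (p1, p2)) (upper (q1, q2)); first by rewrite addbb !andbF.
have -> : upper (p1, p2) (+) upper (q1, q2) = true.
  by move: nU; do 2 case: upper.
rewrite !andbT addbT.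
(* If [p1] vanished, [p2] would be at least [3 d] in absolute value and the step could not change
   half-plane. *)
have: p1 != 0.
  apply: contraNneq nU => p10; move: fp; rewrite p10 normr0; move: dpq.
  rewrite ler_normr ltr_norml => dpq fp; rewrite /upper /=; have [p2_gt|p2_le] := ltP 0 p2.
    by have -> : 0 < q2 by lra.
  have /lt_gtF -> : q2 < 0 by lra.
  have /lt_eqF -> : q2 < 0 by lra.
  by have /lt_eqF -> : p2 < 0 by lra.
by case: ltrgtP.
Qed.

(** Either all four second coordinates are small; then the first ones have a common sign and the
    half-plane changes cancel around the square. Or one of them is at least [3 d] in absolute value;
    any two corners are less than [2 d] apart, so all four lie in the same half-plane. *)
Lemma cross_square d p00 p10 p01 p11 :
  (forall p, p \in [:: p00; p10; p01; p11] ->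
     (3%:R * d <= `|p.1|) || (3%:R * d <= `|p.2|)) ->
  `|p00.1 - p10.1| < d -> `|p00.2 - p10.2| < d ->
  `|p00.1 - p01.1| < d -> `|p00.2 - p01.2| < d ->
  `|p10.1 - p11.1| < d -> `|p10.2 - p11.2| < d ->
  `|p01.1 - p11.1| < d -> `|p01.2 - p11.2| < d ->
  cross p00 p10 (+) cross p01 p11 = cross p00 p01 (+) cross p10 p11.
Proof.
case: p00 => a1 a2; case: p10 => b1 b2; case: p01 => c1 c2; case: p11 => e1 e2 far.
have := far (a1, a2); have := far (b1, b2); have := far (c1, c2); have := far (e1, e2).
rewrite !inE !eqxx ?orbT /= => /(_ isT) fe /(_ isT) fc /(_ isT) fb /(_ isT) fa.
move=> ab1 ab2 ac1 ac2 be1 be2 ce1 ce2; rewrite /cross /=.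
have d0 : 0 < d by apply: le_lt_trans ab1.
move: ab1 ab2 ac1 ac2 be1 be2 ce1 ce2; rewrite !ltr_norml => ab1 ab2 ac1 ac2 be1 be2 ce1 ce2.
have [/and4P[ha hb hc he]|big] := boolP [&& `|a2| < 3%:R * d, `|b2| < 3%:R * d,
    `|c2| < 3%:R * d & `|e2| < 3%:R * d].
  have {}fa : 3%:R * d <= `|a1| by case/orP: fa => // /(lt_le_trans ha); rewrite ltxx.
  move: fa; rewrite !ler_normr => fa.
  have -> : (0 < b1) = (0 < a1) by apply/idP/idP; lra.
  have -> : (0 < c1) = (0 < a1) by apply/idP/idP; lra.
  by case: (0 < a1) => //=; do 4 case: upper.
suff : upper (a1, a2) = upper (b1, b2) /\ upper (a1, a2) = upper (c1, c2) /\
       upper (a1, a2) = upper (e1, e2).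
  by move=> [<- [<- <-]]; rewrite !addbb !andbF.
rewrite /upper /=.
have [[a0 [b0 [c0 e0]]]|[a0 [b0 [c0 e0]]]] : (0 < a2 /\ 0 < b2 /\ 0 < c2 /\ 0 < e2) \/
   (a2 < 0 /\ b2 < 0 /\ c2 < 0 /\ e2 < 0).
- have [h|h] := ltP 0 a2; [left|right]; move: big; rewrite !negb_and -!leNgt !ler_normr;
  lra.
- by rewrite a0 b0 c0 e0.
by rewrite !(lt_gtF a0, lt_gtF b0, lt_gtF c0, lt_gtF e0, lt_eqF a0, lt_eqF b0, lt_eqF c0,
  lt_eqF e0).
Qed.

(** Discrete substitute for a curve inside [S]. A ball of [R * R] is a square, so each step is
    bounded in both coordinates. *)
Fixpoint chain (S : set (R * R)) d x s : Prop :=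
  S x /\ if s is y :: s' then ball x d y /\ chain S d y s' else True.

Lemma chain_head S d x s : chain S d x s -> S x.
Proof. by case: s => [|y s] []. Qed.

Lemma chain_last S d x s : chain S d x s -> S (last x s).
Proof. by elim: s x => [|y s IH] x /= [] // _ [_ /IH]. Qed.

Definition far d p q : Prop := 3%:R * d <= `|p.1 - q.1| \/ 3%:R * d <= `|p.2 - q.2|.

(** Sum of [cross_square] over the steps of the chain; the sides shared by consecutive squares
    cancel. *)
Lemma crossings_strip d (S T : set (R * R)) v w x s :
  (forall p q, S p -> T q -> far d p q) -> T v -> T w -> ball v d w ->
  chain S d x s ->
  crossings (fun z => z - v) x s (+) crossings (fun z => z - w) x s
  = cross (x - v) (x - w) (+) cross (last x s - v) (last x s - w).
Proof.
move=> ST Tv Tw [/= vw1 vw2].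
elim: s x => [|y s IH] x /= [Sx]; first by rewrite addbb.
move=> [[/= xy1 xy2] ys].
have sq : cross (x - v) (y - v) (+) cross (x - w) (y - w)
    = cross (x - v) (x - w) (+) cross (y - v) (y - w).
  apply: (@cross_square d) => /=.
    have farb p q : S p -> T q ->
        (3%:R * d <= `|(p - q).1|) || (3%:R * d <= `|(p - q).2|).
      by move=> Sp Tq; apply/orP; apply: ST.
    have Sy := chain_head ys.
    by move=> p; rewrite !inE => /or4P[] /eqP ->; apply: farb.
- by rewrite (_ : _ - _ = x.1 - y.1) //= opprB addrA subrK.
- by rewrite (_ : _ - _ = x.2 - y.2) //= opprB addrA subrK.
- by rewrite (_ : _ - _ = w.1 - v.1) 1?distrC//= opprB addrC addrA subrK.
- by rewrite (_ : _ - _ = w.2 - v.2) 1?distrC//= opprB addrC addrA subrK.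
- by rewrite (_ : _ - _ = w.1 - v.1) 1?distrC//= opprB addrC addrA subrK.
- by rewrite (_ : _ - _ = w.2 - v.2) 1?distrC//= opprB addrC addrA subrK.
- by rewrite (_ : _ - _ = x.1 - y.1) //= opprB addrA subrK.
- by rewrite (_ : _ - _ = x.2 - y.2) //= opprB addrA subrK.
by rewrite addbACA sq (IH _ ys) addbA addbK.
Qed.

(** [cross_neg] is summed along the chain, and its half-plane terms telescope to the two ends. *)
Lemma crossings_opp d (S T : set (R * R)) w y t :
  (forall p q, S p -> T q -> far d p q) -> S w -> chain T d y t ->
  crossings (fun z => w - z) y t
  = crossings (fun z => z - w) y t (+) (upper (y - w) (+) upper (last y t - w)).
Proof.
move=> ST Sw.
elim: t y => [|z t IH] y /= [Ty]; first by rewrite addbb.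
move=> [[/= yz1 yz2] zt]; rewrite IH //.
rewrite -(opprB y w) -(opprB z w) (@cross_neg d).
- by move: (upper _) (upper _) (upper _) (cross _ _) (crossings _ _ _) => [] [] [] [] [].
- by rewrite /= opprB addrA subrK.
- by apply/orP; rewrite /= distrC (distrC y.2); apply: ST.
- apply/orP; rewrite /= distrC (distrC z.2); apply: ST => //.
  exact: chain_head zt.
Qed.

(* The boundary of the rectangle of all differences e(s) - f(t) has an even
   number of crossings, because every small square has. *)
Lemma crossings_square d (S T : set (R * R)) x s y t :
  (forall p q, S p -> T q -> far d p q) -> chain S d x s -> chain T d y t ->
  crossings (fun z => z - y) x s (+) crossings (fun z => z - last y t) x s
  = crossings (fun z => x - z) y t (+) crossings (fun z => last x s - z) y t.
Proof.
move=> ST xs; elim: t y => [|z t IH] y /= [Ty]; first by rewrite addbb.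
move=> [yz zt]; have strip := crossings_strip ST Ty (chain_head zt) yz xs.
by rewrite addbACA -strip -(IH _ zt) addbA addbK.
Qed.
(** For two independent edges, [crossings_square] with its right side turned by [crossings_opp] is
    one relation of [K33_parity]; the half-plane terms of the four pairs of ends take the places of
    [u], [v], [w] and [z]. *)
Lemma K33_no_far_chains d (a b : nat -> R * R) (e : nat -> nat -> seq (R * R))
    (S : nat -> nat -> set (R * R)) :
  0 < d ->
  (forall i j, (i < 3)%N -> (j < 3)%N ->
     chain (S i j) d (a i) (e i j) /\ last (a i) (e i j) = b j) ->
  (forall i j i' j', (i < 3)%N -> (j < 3)%N -> (i' < 3)%N -> (j' < 3)%N ->
     i != i' -> j != j' -> forall p q, S i j p -> S i' j' q -> far d p q) ->
  False.
Proof.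
move=> d0 ch ind.
have eq i j i' j' : (i < i')%N -> (i' < 3)%N -> (j < 3)%N -> (j' < 3)%N -> j != j' ->
    crossings (fun z => z - a i') (a i) (e i j) (+) crossings (fun z => z - b j') (a i) (e i j)
    (+) (crossings (fun z => z - a i) (a i') (e i' j')
         (+) crossings (fun z => z - b j) (a i') (e i' j'))
    (+) (upper (a i' - a i) (+) upper (b j' - a i)
         (+) (upper (a i' - b j) (+) upper (b j' - b j))) = false.
  move=> ii' i'3 j3 j'3 jj'.
  have i3 := ltn_trans ii' i'3.
  have [ci li] := ch i j i3 j3; have [ci' li'] := ch i' j' i'3 j'3.
  have ST : forall p q, S i j p -> S i' j' q -> far d p q.
    by apply: ind => //; rewrite ltn_eqF.
  have := crossings_square ST ci ci'.
  rewrite (crossings_opp ST (chain_head ci) ci') (crossings_opp ST (chain_last ci) ci').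
  rewrite li li'.
  move=> ->; rewrite !addb_xorb; btauto.
apply: (K33_parity eq) => j j' jj' j'3.
rewrite -opprB upperN // subr_eq0; apply/negP => /eqP bjj'.
have j3 := ltn_trans jj' j'3.
(* [b j] and [b j'] end independent edges from rows 0 and 1, so they are far apart and cannot
   coincide. *)
have [c l] := ch 0%N j isT j3; have [c' l'] := ch 1%N j' isT j'3.
have : far d (b j) (b j').
  apply: (ind 0%N j 1%N j') => //; first by rewrite ltn_eqF.
    by rewrite -l; apply: chain_last c.
  by rewrite -l'; apply: chain_last c'.
by rewrite /far bjj' !subrr normr0; lra.
Qed.

End Parity.

(** * Chains, distances and reachability in the plane *)

Section Chains.
Context {R : realType}.
Local Open Scope ring_scope.
Local Open Scope classical_set_scope.
Implicit Types (p q x y : R * R) (s : seq (R * R)) (d : R) (S T A B K : set (R * R)).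

Lemma chain_cat S d x s s' :
  chain S d x s -> chain S d (last x s) s' -> chain S d x (s ++ s').
Proof. by elim: s x => [|y s IH] x //= [Sx [xy ys]] h; split => //; split => //; apply: IH. Qed.

Lemma chain_rcons S d x s q :
  chain S d x s -> S q -> ball (last x s) d q -> chain S d x (rcons s q).
Proof.
move=> xs Sq xq; rewrite -cats1; apply: chain_cat => //=.
by split; [apply: chain_last xs|].
Qed.

Lemma chain_sub S T d x s : S `<=` T -> chain S d x s -> chain T d x s.
Proof.
move=> ST; elim: s x => [|y s IH] x /= [/ST Sx] // [xy ys].
by split => //; split => //; apply: IH.
Qed.

Lemma locally_constant_connected (C P : set (R * R)) x y :
  connected C ->
  (forall p, C p -> exists2 r : R, 0 < r & forall q, C q -> ball p r q -> P p <-> P q) ->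
  C x -> P x -> C y -> P y.
Proof.
move=> Cc loc Cx Px Cy.
suff CP : C `&` P = C by move: Cy; rewrite -CP => -[].
(* [U Q] is open in the plane, and for [Q] locally constant on [C] it cuts out of [C] exactly the
   points with [Q]. Used for [P] and for its complement, it makes [P] open and closed in [C]. *)
pose U (Q : set (R * R)) : set (R * R) := [set q : R * R | \forall q' \near q, C q' -> Q q'].
have openU Q : open (U Q).
  rewrite openE => q /near_join Uq; near=> q'.
  exact: (near Uq q').
have UP Q q : (forall p, C p -> exists2 r : R, 0 < r & forall q, C q -> ball p r q -> Q p <-> Q q) ->
    (C `&` Q) q -> U Q q.
  move=> locQ [Cq Qq]; have [r r0 h] := locQ q Cq.
  near=> q' => Cq'; apply/(h q' Cq') => //; near: q'; exact: nbhsx_ballx.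
have sub Q : C `&` U Q `<=` C `&` Q by move=> q [Cq /nbhs_singleton h]; split => //; apply: h.
apply: Cc.
- by exists x.
- exists (U P) => //; apply/seteqP; split => [q CPq|]; last exact: sub.
  by split; [case: CPq|apply: UP].
- exists (~` U (~` P)); first exact: open_closedC.
  apply/seteqP; split => q [Cq Pq]; split => //.
    by move=> /nbhs_singleton /(_ Cq).
  apply: contrapT => nPq; apply: Pq; apply: UP => // p Cp.
  have [r r0 h] := loc p Cp; exists r => // q' Cq' pq'.
  by have [h1 h2] := h q' Cq' pq'; split=> nP ?; apply: nP; [apply: h2|apply: h1].
Unshelve. all: by end_near.
Qed.

(** Being joined to [x] by a chain of step [d] is locally constant on [S]. *)
Lemma connected_chain S d x y : connected S -> 0 < d -> S x -> S y ->
  exists2 s, chain S d x s & last x s = y.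
Proof.
move=> Sc d0 Sx Sy.
pose P q := exists2 s, chain S d x s & last x s = q.
apply: (@locally_constant_connected S P x y) => // [p Sp|]; last by exists [::].
exists d => // q Sq pq.
split=> -[s cs ls].
  by exists (rcons s q); rewrite ?last_rcons //; apply: chain_rcons; rewrite // ls.
exists (rcons s p); rewrite ?last_rcons //; apply: chain_rcons; rewrite // ls.
exact: ball_sym.
Qed.

Lemma path_chain (f : R -> R * R) d :
  {within `[0, 1], continuous f} -> 0 < d ->
  exists2 s, chain (f @` `[0, 1]) d (f 0) s & last (f 0) s = f 1.
Proof.
move=> fc d0; apply: connected_chain => //.
- by apply: connected_continuous_connected => //; apply: segment_connected.
- by exists 0 => //=; rewrite in_itv /= lexx ler01.
- by exists 1 => //=; rewrite in_itv /= lexx ler01.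
Qed.

Lemma finite_uniform (T : finType) (P : T -> R -> Prop) :
  (forall t d d', P t d -> 0 < d' -> d' <= d -> P t d') ->
  (forall t, exists2 d, 0 < d & P t d) -> exists2 d, 0 < d & forall t, P t d.
Proof.
move=> mono ex.
suff [d d0 h] : exists2 d, 0 < d & forall t, t \in enum T -> P t d.
  by exists d => // t; apply: h; rewrite mem_enum.
elim: (enum T) => [|t s [d d0 h]]; first by exists 1.
have [d' d'0 ht] := ex t; exists (Num.min d d'); first by rewrite lt_min d0.
move=> u; rewrite inE => /orP[/eqP ->|/h Pu].
  by apply: (mono _ d') => //; [rewrite lt_min d0|rewrite ge_min lexx orbT].
by apply: (mono _ d) => //; [rewrite lt_min d0|rewrite ge_min lexx].
Qed.

Lemma closed_far K x : closed K -> ~ K x -> exists2 d, 0 < d & forall y, ball x d y -> ~ K y.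
Proof.
move=> /closed_openC; rewrite openE => Kc nK.
by have /nbhs_ballP[d d0 h] := Kc x nK; exists d.
Qed.

Lemma compact_disjoint_far A B : compact A -> closed B -> A `&` B = set0 ->
  exists2 d, 0 < d & forall x y, A x -> B y -> ~ ball x d y.
Proof.
move=> /compact_near_coveringP cA cB AB.
(* Compactness in its near-covering form: at each point of [A], half of a local clearance also
   serves the nearby points. *)
have cov : \forall d \near (0 : R)^'+, A `<=` [set x | forall y, B y -> ~ ball x d y].
  apply: cA => x Ax; have [|d d0 h] := @closed_far B x cB.
    by move=> Bx; suff : set0 x by []; rewrite -AB.
  exists (ball x (d / 2), [set r | r < d / 2]) => /=.
    split; first exact: nbhsx_ballx (divr_gt0 d0 _).
    by apply: nbhs_right_lt; rewrite divr_gt0.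
  move=> [z r] /= [xz rd] y By zy.
  apply: (h y) => //; rewrite [d]splitr; apply: ball_triangle xz _.
  by apply: le_ball zy; apply: ltW.
have [d [/= Ad d0]] : exists d : R, A `<=` [set x | forall y, B y -> ~ ball x d y] /\ 0 < d.
  near (0 : R)^'+ => d; exists d; split; near: d; first exact: cov.
  exact: nbhs_right_gt.
by exists d => // x y Ax; apply: Ad.
Unshelve. all: by end_near.
Qed.

Lemma far_ball d p q : ~ ball p d q -> far (d / 3%:R) p q.
Proof.
move=> npq; rewrite /far mulrC divfK //; have [|pq1] := leP d `|p.1 - q.1|; first by left.
by right; rewrite leNgt; apply/negP => pq2; apply: npq; split.
Qed.

Lemma segment_chain S x y d : 0 < d ->
  (forall t, 0 <= t <= 1 -> S (x + t *: (y - x))) ->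
  exists2 s, chain S d x s & last x s = y.
Proof.
move=> d0 xyS; pose f t := x + t *: (y - x).
have fc : {within `[0, 1], continuous f}.
  apply: continuous_subspaceT => t; apply: cvgD; first exact: cvg_cst.
  by apply: cvgZr_tmp; exact: cvg_id.
have [s cs ls] := path_chain fc d0.
have f0 : f 0 = x by rewrite /f scale0r addr0.
have f1 : f 1 = y by rewrite /f scale1r addrC subrK.
rewrite f0 f1 in cs ls.
exists s => //; apply: chain_sub cs => _ [t /= t01 <-]; apply: xyS.
by rewrite in_itv in t01.
Qed.

Lemma finite_union_compact (T : finType) (F : T -> set (R * R)) :
  (forall t, compact (F t)) -> compact [set p | exists t, F t p].
Proof.
move=> cF; suff -> : [set p | exists t, F t p] = \big[setU/set0]_(t <- enum T) F t.
  by apply: bigsetU_compact => t _.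
rewrite -bigcup_seq; apply/seteqP; split => p [t].
  by move=> Fp; exists t => //=; rewrite mem_enum.
by move=> _ Fp; exists t.
Qed.

(** * Points joined by chains with clearance from a given set *)

Definition avoid K d : set (R * R) := [set p | forall q, K q -> ~ ball p d q].

Lemma avoid_le K d d' : d' <= d -> avoid K d `<=` avoid K d'.
Proof. by move=> dd' p pK q Kq pq; apply: (pK q Kq); apply: le_ball pq. Qed.

(** The clearance [d] is fixed before the step [e], which is later chosen small against it. *)
Definition reach K p q : Prop := exists2 d, 0 < d &
  forall e, 0 < e -> exists2 s, chain (avoid K d) e p s & last p s = q.

Lemma reach_trans K p q r : reach K p q -> reach K q r -> reach K p r.
Proof.
move=> [d d0 pq] [d' d'0 qr]; exists (Num.min d d'); first by rewrite lt_min d0.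
move=> e e0; have [s cs ls] := pq e e0; have [t ct lt] := qr e e0.
exists (s ++ t); last by rewrite last_cat ls.
apply: chain_cat; first by apply: chain_sub cs; apply: avoid_le; rewrite ge_min lexx.
by rewrite ls; apply: chain_sub ct; apply: avoid_le; rewrite ge_min lexx orbT.
Qed.

Lemma reach_segment K d p q : 0 < d ->
  (forall t, 0 <= t <= 1 -> avoid K d (p + t *: (q - p))) -> reach K p q.
Proof. by move=> d0 pq; exists d => // e e0; apply: segment_chain. Qed.

Lemma ball_segment p d q t : ball p d q -> 0 <= t <= 1 -> ball p d (p + t *: (q - p)).
Proof.
case: p q => p1 p2 [q1 q2] [/= pq1 pq2] /andP[t0 t1].
have aux (a b : R) : `|a - b| < d -> `|a - (a + t * (b - a))| < d.
  move=> ab; rewrite opprD addrA subrr sub0r normrN normrM ger0_norm // distrC.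
  by apply: le_lt_trans ab; rewrite ler_piMl.
by split; apply: aux.
Qed.

Lemma reach_ball K d p q : avoid K d p -> ball p (d / 2) q -> reach K p q /\ reach K q p.
Proof.
move=> pK pq.
have d0 : 0 < d / 2 by case: pq => /= pq _; apply: le_lt_trans pq.
have av r : ball p (d / 2) r -> avoid K (d / 2) r.
  by move=> pr k Kk rk; apply: (pK k Kk); rewrite [d]splitr; apply: ball_triangle pr rk.
split; apply: (reach_segment d0) => t t01; apply: av; first exact: ball_segment.
rewrite (_ : q + _ = p + (1 - t) *: (q - p)); last first.
  by rewrite scalerBl scale1r addrA [p + (_ - _)]addrC subrK -scalerN opprB.
by apply: ball_segment => //; move: t01; lra.
Qed.

(** By [reach_ball], being reached from [p] is locally constant off [K]. *)
Lemma reach_component K p q : closed K ->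
  connected_component (~` K) p q -> reach K p q.
Proof.
move=> cK pq; set C := connected_component (~` K) p.
have CK : C `<=` ~` K by apply: connected_component_sub.
have pK : (~` K) p.
  by apply: contrapT => nKp; move: pq; rewrite connected_component_out.
have Cp : C p by apply: connected_component_refl.
have farC r : C r -> exists2 d, 0 < d & avoid K d r.
  move=> /CK /(closed_far cK)[d d0 h]; exists d => // k Kk rk; exact: (h k).
apply: (@locally_constant_connected C (reach K p) p q) => //.
- exact: component_connected.
- move=> r Cr; have [d d0 rK] := farC r Cr; exists (d / 2); first by rewrite divr_gt0.
  move=> r' Cr' rr'; have [h1 h2] := reach_ball rK rr'.
  by split => h; apply: reach_trans h _.
- have [d d0 hp] := farC p Cp; exists d => // e e0.
  by exists [::].
Qed.

Lemma reach_outside K (M : R) p :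
  (forall k, K k -> `|k.1| <= M /\ `|k.2| <= M) ->
  M < `|p.1| \/ M < `|p.2| -> reach K (M + 1, M + 1) p.
Proof.
move=> KM pM.
(* For a linear form [f] that is at most [M] on [K], the half-plane [f > M] is convex, so a segment
   in it has clearance [m - M]. Four such half-planes cover the outside of the square, and two
   segments lead from the corner to any point there. *)
have half (f : R * R -> R) x y : (forall k, K k -> f k <= M) ->
    (forall z z' e, ball z e z' -> f z < f z' + e) ->
    (forall t, f (x + t *: (y - x)) = f x + t * (f y - f x)) ->
    M < f x -> M < f y -> reach K x y.
  move=> Kf bf sf fx fy; pose m := Num.min (f x) (f y).
  have d0 : 0 < m - M by rewrite subr_gt0 lt_min fx.
  apply: (reach_segment d0) => t /andP[t0 t1] k Kk /bf; rewrite sf.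
  have mx : m <= f x by rewrite ge_min lexx.
  have my : m <= f y by rewrite ge_min lexx orbT.
  by have := Kf k Kk; nra.
have halfx (c : R) x y : c \in [:: 1; -1] -> M < c * x.1 -> M < c * y.1 -> reach K x y.
  move=> cE; apply: (half (fun z => c * z.1)).
  - by move=> k /KM[]; rewrite ler_norml; move: cE; rewrite !inE => /orP[] /eqP ->; lra.
  - move=> z z' e [zz' _]; have : `|z.1 - z'.1| < e := zz'; rewrite ltr_norml.
    by move: cE; rewrite !inE => /orP[] /eqP ->; lra.
  - by move=> t; rewrite (_ : _.1 = x.1 + t * (y.1 - x.1)) //; ring.
have halfy (c : R) x y : c \in [:: 1; -1] -> M < c * x.2 -> M < c * y.2 -> reach K x y.
  move=> cE; apply: (half (fun z => c * z.2)).
  - by move=> k /KM[_]; rewrite ler_norml; move: cE; rewrite !inE => /orP[] /eqP ->; lra.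
  - move=> z z' e [_ zz']; have : `|z.2 - z'.2| < e := zz'; rewrite ltr_norml.
    by move: cE; rewrite !inE => /orP[] /eqP ->; lra.
  - by move=> t; rewrite (_ : _.2 = x.2 + t * (y.2 - x.2)) //; ring.
have [c1 cN1] : (1 : R) \in [:: 1; -1] /\ (-1 : R) \in [:: 1; -1].
  by rewrite !inE !eqxx orbT.
case: pM; rewrite lter_normr => /orP[] pM.
- apply: (@reach_trans _ _ (M + 1, p.2)); apply: (halfx 1) => //=; lra.
- apply: (@reach_trans _ _ (p.1, M + 1)).
    by apply: (halfy 1) => //=; lra.
  by apply: (halfx (-1)) => //=; lra.
- apply: (@reach_trans _ _ (p.1, M + 1)); apply: (halfy 1) => //=; lra.
- apply: (@reach_trans _ _ (M + 1, p.2)).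
    by apply: (halfx 1) => //=; lra.
  by apply: (halfy (-1)) => //=; lra.
Qed.

End Chains.
(** * Outerplanar drawings contain no K_{2,3} *)

Section Drawing.
Context {R : realType} {G : sgraph} (D : plane_drawing R G).
Local Open Scope ring_scope.
Local Open Scope classical_set_scope.
Implicit Types (u v w : G) (d : R) (p q : seq G).

Definition edge_curve u v : set (R * R) := Defs.arc D u v @` `[0, 1].

Lemma edge_curve_compact u v : edge u v -> compact (edge_curve u v).
Proof.
by move=> uv; apply: continuous_compact (@segment_compact R 0 1); apply: arc_continuous.
Qed.

Lemma edge_curveP u v (x : R * R) : edge u v -> edge_curve u v x ->
  [\/ x = pos D u, x = pos D v | exists2 t, t \in `]0, 1[ & x = Defs.arc D u v t].
Proof.
move=> uv [t /= + <-]; rewrite in_itv /= => /andP[t0 t1].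
have [->|tn0] := eqVneq t 0; first by rewrite arc0 //; constructor 1.
have [->|tn1] := eqVneq t 1; first by rewrite arc1 //; constructor 2.
by constructor 3; exists t => //; apply: mem_set; rewrite /= in_itv /= !lt_neqAle t0 t1 tn1 eq_sym tn0.
Qed.

Lemma pos_edge_curve u v : edge u v -> edge_curve u v (pos D u) /\ edge_curve u v (pos D v).
Proof.
move=> uv; split.
  by exists 0; [rewrite /= in_itv /= ler01 lexx|exact: arc0].
by exists 1; [rewrite /= in_itv /= ler01 lexx|exact: arc1].
Qed.

Lemma vertex_notin_edge_curve u v w : edge u v -> w != u -> w != v ->
  ~ edge_curve u v (pos D w).
Proof.
move=> uv /eqP wu /eqP wv /(edge_curveP uv)[/pos_inj//|/pos_inj//|[t t01 wt]].
exact: (arc_vertex uv t01 (esym wt)).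
Qed.

Lemma edge_curves_disjoint u v u' v' : edge u v -> edge u' v' ->
  u != u' -> u != v' -> v != u' -> v != v' -> edge_curve u v `&` edge_curve u' v' = set0.
Proof.
move=> uv u'v' uu' uv' vu' vv'; rewrite -subset0 => x [xuv xu'v'].
have [xu|xv|[t t01 xt]] := edge_curveP uv xuv.
- by apply: (vertex_notin_edge_curve u'v' uu' uv'); rewrite -xu.
- by apply: (vertex_notin_edge_curve u'v' vu' vv'); rewrite -xv.
have [xu'|xv'|[s s01 xs]] := edge_curveP u'v' xu'v'.
- by apply: (vertex_notin_edge_curve uv (w := u')); rewrite -?xu' // eq_sym.
- by apply: (vertex_notin_edge_curve uv (w := v')); rewrite -?xv' // eq_sym.
by case: (arc_cross uv u'v' t01 s01 (etrans (esym xt) xs)) => -[eu ev]; [move: uu'|move: uv']; rewrite eu eqxx.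
Qed.

Lemma R2_hausdorff : hausdorff_space (R * R)%type.
Proof. exact: norm_hausdorff. Qed.

Lemma drawn_points_compact : compact (drawn_points D).
Proof.
pose F (e : G * G) := if edge e.1 e.2 then edge_curve e.1 e.2 else set0.
rewrite (_ : drawn_points D =
   [set x | exists v, [set pos D v] x] `|` [set x | exists e, F e x]); last first.
  apply/seteqP; split => x [] /=.
  - by move=> xv; left.
  - by move=> [u [v [uv xuv]]]; right; exists (u, v); rewrite /F /= uv.
  - by move=> xv; left.
  - move=> [[u v]]; rewrite /F /=; case: ifP => // uv xuv.
    by right; exists u, v.
apply: compactU; apply: finite_union_compact; first by move=> v; exact: compact_set1.
move=> [u v].
by rewrite /F /=; case: ifP => uv; [apply: edge_curve_compact|apply: compact0].
Qed.

Lemma drawn_points_bounded : exists M : R,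
  forall x, drawn_points D x -> `|x.1| <= M /\ `|x.2| <= M.
Proof.
have [M [_ hM]] := compact_bounded drawn_points_compact.
exists (M + 1) => x Kx.
have : `|x| <= M + 1 by apply: hM => //; rewrite ltrDl.
by rewrite prod_normE ge_max => /andP.
Qed.

(** An unbounded component leaves the square of radius [M], outside which every point is joined to
    the corner [(M + 1, M + 1)]. This corner serves as the extra vertex of K_{3,3}. *)
Lemma outer_face_reach (M : R) x :
  (forall x, drawn_points D x -> `|x.1| <= M /\ `|x.2| <= M) ->
  outer_face D x -> reach (drawn_points D) (M + 1, M + 1) x.
Proof.
move=> KM xout.
have [y xy My] : exists2 y, connected_component (~` drawn_points D) x y &
    M < `|y.1| \/ M < `|y.2|.
  apply: contrapT => nex; apply: xout; exists M; split => [|N MN y /= xy].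
    exact: num_real.
  apply: le_trans (ltW MN); rewrite prod_normE ge_max; apply/andP.
  by split; rewrite leNgt; apply/negP => My; apply: nex; exists y => //; [left|right].
apply: reach_trans (reach_outside KM My) _.
apply: reach_component; last exact: connected_component_sym.
exact: compact_closed R2_hausdorff drawn_points_compact.
Qed.

Lemma edge_curves_far : exists2 d, 0 < d & forall u v u' v', edge u v -> edge u' v' ->
  u != u' -> u != v' -> v != u' -> v != v' ->
  forall x y, edge_curve u v x -> edge_curve u' v' y -> ~ ball x d y.
Proof.
pose P (t : G * G * (G * G)) d := let: ((u, v), (u', v')) := t in
  edge u v -> edge u' v' -> u != u' -> u != v' -> v != u' -> v != v' ->
  forall x y, edge_curve u v x -> edge_curve u' v' y -> ~ ball x d y.
have [|[[u v] [u' v']]|d d0 h] := @finite_uniform R _ P.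
- move=> [[u v] [u' v']] d d' h d'0 d'd uv u'v' h1 h2 h3 h4 x y xuv yuv xy.
  by apply: (h uv u'v' h1 h2 h3 h4 x y xuv yuv); apply: le_ball xy.
- rewrite /P; have [uv|] := boolP (edge u v); last by exists 1.
  have [u'v'|] := boolP (edge u' v'); last by exists 1.
  have [h1|] := boolP (u != u'); last by exists 1.
  have [h2|] := boolP (u != v'); last by exists 1.
  have [h3|] := boolP (v != u'); last by exists 1.
  have [h4|] := boolP (v != v'); last by exists 1.
  have [||//|d d0 h] := @compact_disjoint_far R (edge_curve u v) (edge_curve u' v').
  + exact: edge_curve_compact.
  + exact: compact_closed R2_hausdorff (edge_curve_compact _).
  + exact: edge_curves_disjoint.
  by exists d => // *; apply: h.
by exists d => // u v u' v' *; apply: (h ((u, v), (u', v'))).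
Qed.

Lemma vertex_far w : exists2 d, 0 < d & forall u v, edge u v -> w != u -> w != v ->
  avoid (edge_curve u v) d (pos D w).
Proof.
pose P (t : G * G) d := edge t.1 t.2 -> w != t.1 -> w != t.2 ->
  avoid (edge_curve t.1 t.2) d (pos D w).
have [|[u v]|d d0 h] := @finite_uniform R _ P.
- move=> [u v] d d' h d'0 d'd uv wu wv; exact: avoid_le d'd _ (h uv wu wv).
- rewrite /P /=; have [uv|] := boolP (edge u v); last by exists 1.
  have [wu|] := boolP (w != u); last by exists 1.
  have [wv|] := boolP (w != v); last by exists 1.
  have [||d d0 h] := @closed_far R (edge_curve u v) (pos D w).
  + exact: compact_closed R2_hausdorff (edge_curve_compact _).
  + exact: vertex_notin_edge_curve.
  by exists d => // _ _ _ y yuv wy; apply: (h y).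
by exists d => // u v; apply: (h (u, v)).
Qed.

Lemma walk_chain (A : pred G) (S : set (R * R)) d v p : 0 < d ->
  (forall u w, edge u w -> A u -> A w -> edge_curve u w `<=` S) ->
  S (pos D v) -> path (@edge G) v p -> all A (v :: p) ->
  exists2 s, chain S d (pos D v) s & last (pos D v) s = pos D (last v p).
Proof.
move=> d0 AS; elim: p v => [|w p IH] v Sv /=; first by exists [::].
move=> /andP[vw wp] /and3P[Av Aw Ap].
have vwS := AS v w vw Av Aw.
have Sw : S (pos D w) by apply: vwS; case: (pos_edge_curve vw).
have [s cs ls] : exists2 s, chain S d (pos D v) s & last (pos D v) s = pos D w.
  have [s] := path_chain (arc_continuous (p := D) vw) d0; rewrite arc0 // arc1 // => cs ls.
  by exists s => //; apply: chain_sub cs.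
have [|t ct lt] := IH w Sw wp; first by rewrite /= Aw.
by exists (s ++ t); [apply: chain_cat => //; rewrite ls|rewrite last_cat ls].
Qed.

(** Edges at [w] are exempt, since a chain ending at [w] must come near them. *)
Definition clear_of w d : set (R * R) :=
  [set x | forall u v, edge u v -> w != u -> w != v -> avoid (edge_curve u v) d x].

Lemma clear_of_le w d d' : d' <= d -> clear_of w d `<=` clear_of w d'.
Proof. by move=> dd x h u v uv wu wv; apply: avoid_le dd _ (h u v uv wu wv). Qed.

(** A point of the outer face close to the vertex is reached from the corner; a segment inside a
    small ball around the vertex does the rest. *)
Lemma reach_vertex (M : R) w :
  (forall x, drawn_points D x -> `|x.1| <= M /\ `|x.2| <= M) ->
  closure (outer_face D) (pos D w) ->
  exists2 d, 0 < d & forall e, 0 < e -> exists2 s,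
    chain (clear_of w d) e (M + 1, M + 1) s & last (M + 1, M + 1) s = pos D w.
Proof.
move=> KM wout; have [d d0 wd] := vertex_far w.
have dd0 : 0 < d / 2 by rewrite divr_gt0.
have [x [xout wx]] := wout _ (nbhsx_ballx (pos D w) _ dd0).
have [d' d'0 ox] := outer_face_reach KM xout.
exists (Num.min d' (d / 2)); first by rewrite lt_min d'0.
move=> e e0; have [s cs ls] := ox e e0.
have [t ct lt] : exists2 t, chain (clear_of w (d / 2)) e x t & last x t = pos D w.
  apply: segment_chain => // t t01 u v uv wu wv y yuv xy.
  apply: (wd u v uv wu wv y yuv); rewrite [d]splitr; apply: ball_triangle xy.
  rewrite (_ : x + _ = pos D w + (1 - t) *: (x - pos D w)).
    by apply: ball_segment => //; move: t01; lra.
  by rewrite scalerBl scale1r addrA [pos D w + (_ - _)]addrC subrK -scalerN opprB.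
exists (s ++ t); last by rewrite last_cat ls.
apply: chain_cat.
  apply: chain_sub cs => y yK; apply: (@clear_of_le _ d'); first by rewrite ge_min lexx.
  by move=> u v uv _ _ k kuv; apply: yK; right; exists u, v.
rewrite ls; apply: chain_sub ct; apply: clear_of_le.
by rewrite ge_min lexx orbT.
Qed.

(** The walks draw K_{3,3}: one side consists of the corner [(M + 1, M + 1)], [z] and [z'], the
    other of the three meeting points [m j]. *)
Lemma outerplanar_drawing_no_K23 (z z' : G) (p q : nat -> seq G) :
  (forall v, closure (outer_face D) (pos D v)) ->
  (forall j, (j < 3)%N -> [/\ path (@edge G) z (p j), path (@edge G) z' (q j) &
     last z (p j) = last z' (q j)]) ->
  (forall i j, (i < 3)%N -> (j < 3)%N -> i != j ->
     forall u, u \in z :: p i -> u \notin z' :: q j) ->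
  False.
Proof.
move=> out pq dis; have [M KM] := drawn_points_bounded.
have [|w|d1 d10 h1] := @finite_uniform R G (fun w d => forall e, 0 < e -> exists2 s,
    chain (clear_of w d) e (M + 1, M + 1) s & last (M + 1, M + 1) s = pos D w).
- move=> w d d' h d'0 d'd e e0; have [s cs ls] := h e e0.
  by exists s => //; apply: chain_sub cs; apply: clear_of_le.
- exact: reach_vertex.
have [d2 d20 h2] := edge_curves_far.
pose d := Num.min d1 d2; have d0 : 0 < d by rewrite lt_min d10.
have d30 : 0 < d / 3%:R by rewrite divr_gt0.
pose W (l : seq G) : set (R * R) :=
  [set x | exists u v, [/\ edge u v, u \in l, v \in l & edge_curve u v x]].
pose m j := last z (p j).
pose a i : R * R := if i is i'.+1 then if i' is 0%N then pos D z else pos D z' else (M + 1, M + 1).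
pose S i j := if i is i'.+1 then if i' is 0%N then W (z :: p j) else W (z' :: q j)
  else clear_of (m j) d.
have mp j : m j \in z :: p j by rewrite /m mem_last.
have mq j : (j < 3)%N -> m j \in z' :: q j by move=> /pq[_ _]; rewrite /m => ->; apply: mem_last.
(* A second column shows that the walks are nonempty: [p j = [::]] would put [z] on [z' :: q j],
   although [z] also starts the walk [p (other j)]. The argument for [q j] is the same. *)
have [other [oth oth3]] : exists other : nat -> nat,
    (forall j, (other j < 3)%N) /\ forall j, j != other j.
  by exists (fun j => if j is 0%N then 1%N else 0%N); split; case.
have walk v l : path (@edge G) v l -> l != [::] ->
    exists2 s, chain (W (v :: l)) (d / 3%:R) (pos D v) s & last (pos D v) s = pos D (last v l).
  move=> vl l0; apply: (walk_chain (A := mem (v :: l))) => //.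
  - by move=> u w uw ul wl x xuw; exists u, w; split.
  - case: l l0 vl => [|w l _ /= /andP[vw _]]; first by rewrite eqxx.
    exists v, w; rewrite !inE !eqxx orbT; split => //.
    by case: (pos_edge_curve vw).
have ch i j : exists s, (i < 3)%N -> (j < 3)%N ->
    chain (S i j) (d / 3%:R) (a i) s /\ last (a i) s = pos D (m j).
  have [i3|] := boolP (i < 3)%N; last by exists [::].
  have [j3|] := boolP (j < 3)%N; last by exists [::].
  have [zp z'q zz'] := pq j j3; have jo := oth3 j.
  case: i i3 => [|[|[|//]]] _.
  - have [s cs ls] := h1 (m j) _ d30; exists s => _ _; split => //.
    by apply: chain_sub cs; apply: clear_of_le; rewrite ge_min lexx.
  - have [|s cs ls] := walk z (p j) zp; last by exists s.
    apply/eqP => p0; have := dis (other j) j (oth j) j3; rewrite eq_sym => /(_ jo z).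
    by rewrite mem_head => /(_ isT)/negP[]; have := mq j j3; rewrite /m p0.
  - have [|s cs ls] := walk z' (q j) z'q; last by exists s; rewrite /m zz'.
    apply/eqP => q0; have := dis j (other j) j3 (oth j) jo z'.
    by rewrite mem_head => /(_ _)/negP[] //; have := mp j; rewrite /m zz' q0.
pose e i j := sval (cid (ch i j)).
have far_sym (x y : R * R) c : far c x y -> far c y x.
  by rewrite /far distrC (distrC x.2).
apply: (@K33_no_far_chains R (d / 3%:R) a (fun j => pos D (m j)) e S) => //.
  by move=> i j i3 j3; apply: (svalP (cid (ch i j))).
have clearW j l x y : clear_of (m j) d x -> m j \notin l -> W l y -> far (d / 3%:R) x y.
  move=> xj jl [u [v [uv ul vl yuv]]]; apply: far_ball; apply: (xj u v) => //.
    by apply: contraNneq jl => ->.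
  by apply: contraNneq jl => ->.
have WW l l' x y : (forall u, u \in l -> u \notin l') -> W l x -> W l' y -> far (d / 3%:R) x y.
  move=> ll' [u [v [uv ul vl xuv]]] [u' [v' [uv' ul' vl' yuv]]].
  apply: far_ball => xy; apply: (h2 u v u' v' _ _ _ _ _ _ x y) => //.
  1-4: by [apply: contraTneq ul' => <-; apply: ll'|apply: contraTneq vl' => <-; apply: ll'].
  by apply: le_ball xy; rewrite ge_min lexx orbT.
move=> i j i' j' i3 j3 i'3 j'3 ii' jj' x y.
have pj1 : m j \notin z :: p j'.
  by apply/negP => /(dis j' j j'3 j3 _)/negP; rewrite eq_sym mq //; apply.
have pj2 : m j' \notin z :: p j.
  by apply/negP => /(dis j j' j3 j'3 jj')/negP; rewrite mq.
have qj1 : m j \notin z' :: q j' by apply: dis jj' _ _.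
have qj2 : m j' \notin z' :: q j by apply: dis (mp j'); rewrite // eq_sym.
have d12 := dis j j' j3 j'3 jj'.
have d21 : forall u, u \in z' :: q j -> u \notin z :: p j'.
  by move=> u uq; apply: contraTN uq => up; apply: dis up; rewrite // eq_sym.
case: i i3 ii' => [|[|[|//]]] _; case: i' i'3 => [|[|[|//]]] _ //= _.
- by move=> h; apply: clearW h _.
- by move=> h; apply: clearW h _.
- by move=> h h'; apply/far_sym; apply: clearW h' _ h.
- exact: WW.
- by move=> h h'; apply/far_sym; apply: clearW h' _ h.
- exact: WW.
Qed.

End Drawing.

(** * Reducible configurations *)

Section Structure.
Context {G : sgraph}.
Local Open Scope nat_scope.
Local Notation "u -- v" := (@edge G u v) (at level 70).
Implicit Types (u v w x y z : G) (p q s : seq G) (D S : {set G}).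

(* Only walks belonging to different blocks and starting at different branch
   vertices have to be disjoint. *)
Definition K23_free (H : sgraph) : Prop :=
  forall (z z' : H) (p q : nat -> seq H),
  (forall j, j < 3 -> [/\ path (@edge H) z (p j), path (@edge H) z' (q j) &
     last z (p j) = last z' (q j)]) ->
  ~ (forall i j, i < 3 -> j < 3 -> i != j ->
     forall u : H, u \in z :: p i -> u \notin z' :: q j).

Lemma edgeC u v : (u -- v) = (v -- u).
Proof. exact: edge_sym. Qed.

Lemma edge_neq u v : u -- v -> u != v.
Proof. by apply: contraTneq => ->; rewrite edge_irr. Qed.

(** [D] hangs on the rest of [S] by at most a vertex, when [x = y], or an edge. *)
Definition attached S D x y : Prop :=
  [/\ x \in S /\ y \in S, (x == y) || (x -- y), x \notin D /\ y \notin D, D \subset S &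
      forall d u, d \in D -> u \in S -> d -- u -> [|| u \in D, u == x | u == y]].

(** A vertex without neighbours in [S] is included, with arbitrary [x]. *)
Definition pendant_vertex S v d x : Prop :=
  [/\ d \in S, d != v & forall u, u \in S -> d -- u -> u = x].

(** [last x p1] and [head y p2] are the predecessor and the successor of [u] on the path from [x] to
    [y]. *)
Definition pendant_path S v x y p : Prop :=
  [/\ x \in S /\ y \in S, [/\ uniq p, v \notin p, x \notin p & y \notin p],
      {subset p <= S}, path (@edge G) x (rcons p y) &
      forall p1 u p2, p = p1 ++ u :: p2 ->
        forall w, w \in S -> u -- w -> w = last x p1 \/ w = head y p2].

(** In the application [x -- y], so the empty walk has to be ruled out. Repetitions are removed from
    the first vertex [h] on, and [h] itself is kept. *)
Lemma shortest_link x y D p : p != [::] -> {subset p <= D} ->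
  path (@edge G) x (rcons p y) ->
  exists p', [/\ p' != [::], uniq p', {subset p' <= D}, path (@edge G) x (rcons p' y) &
    forall q, q != [::] -> {subset q <= D} -> path (@edge G) x (rcons q y) ->
      size p' <= size q].
Proof.
move=> p0 pD xpy.
pose P n := `[< exists q, [/\ q != [::], {subset q <= D}, path (@edge G) x (rcons q y) &
   size q = n] >].
have exP : exists n, P n by exists (size p); apply/asboolP; exists p.
case: (ex_minnP exP) => n /asboolP[q [q0 qD xqy <-]] minq.
case: q q0 qD xqy minq => [|h t]; first by rewrite eqxx.
move=> _ htD; rewrite rcons_cons /= rcons_path => /and3P[xh ht ty] minq.
move: ty; case: (shortenP ht) => t' ht' uht' sub ty.
have tt' : size t' <= size t by apply: uniq_leq_size sub; case/andP: uht'.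
exists (h :: t'); split => //.
- move=> u; rewrite inE => /orP[/eqP ->|/sub ut]; first by rewrite htD // mem_head.
  by rewrite htD // inE ut orbT.
- by rewrite rcons_cons /= xh rcons_path ht'.
- move=> q q0 qD xqy; apply: leq_trans (minq (size q) _); first by rewrite /= ltnS.
  by apply/asboolP; exists q.
Qed.

Lemma K23_free_blocks z z' (B : nat -> {set G}) (p q : nat -> seq G) :
  K23_free G -> z != z' ->
  (forall j, j < 3 -> [/\ path (@edge G) z (p j), path (@edge G) z' (q j) &
     last z (p j) = last z' (q j)]) ->
  (forall j, j < 3 -> {subset p j <= B j} /\ {subset q j <= B j}) ->
  (forall j, j < 3 -> z \notin B j /\ z' \notin B j) ->
  ~ (forall i j u, i < 3 -> j < 3 -> u \in B i -> u \in B j -> i = j).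
Proof.
move=> free zz' pq pqB zB disj; apply: (free z z' p q pq) => i j i3 j3 ij u up.
apply/negP => uq; move: up uq.
have [pB _] := pqB i i3; have [_ qB] := pqB j j3.
have [zi z'i] := zB i i3; have [zj z'j] := zB j j3.
rewrite !inE => /orP[/eqP->|/pB Bu] /orP[/eqP uz'|/qB Bu'].
- by rewrite uz' eqxx in zz'.
- by move: zj; rewrite Bu'.
- by move: z'i; rewrite -uz' Bu.
- by move/eqP: ij; apply; apply: disj Bu Bu'.
Qed.

Lemma path_in D u p : path [rel u w | [&& u -- w, u \in D & w \in D]] u p ->
  u \in D -> path (@edge G) u p /\ {subset u :: p <= D}.
Proof.
elim: p u => [|w p IH] u /= up uD; first by split => // w; rewrite inE => /eqP ->.
case/andP: up => /and3P[uw _ wD] /IH /(_ wD)[wp sub]; split; first by rewrite uw.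
by move=> z; rewrite inE => /orP[/eqP ->|/sub].
Qed.

(** Passing to a connected component of [D] creates no new outside neighbours. *)
Lemma attached_connected S D x y w0 : attached S D x y -> w0 \in D ->
  attached S [set w in D | connect [rel u w | [&& u -- w, u \in D & w \in D]] w0 w] x y.
Proof.
move=> [xyS xy [xD yD] DS Dcl] w0D; split => //.
- by rewrite !inE (negPf xD) (negPf yD).
- by apply: (fintype.subset_trans _ DS); apply/fintype.subsetP => w; rewrite inE => /andP[].
- move=> d u; rewrite !inE => /andP[dD w0d] uS du.
  have /or3P[uD|->|->] := Dcl d u dD uS du; rewrite ?orbT //.
  by rewrite uD (connect_trans w0d) // connect1 //= du dD.
Qed.

(** Choose [d] in [D], adjacent to [z] if possible. Then [D :\ d] is attached to the edge from [z]
    to [d], or to [d] alone if nothing in [D] is adjacent to [z]; by minimality [d] is the only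
    vertex of [D]. *)
Lemma attached_one_pendant S D z v : attached S D z z -> D != finset.set0 -> v \notin D ->
  (forall D' x' y', attached S D' x' y' -> D' != finset.set0 -> D' \subset D -> #|D| <= #|D'|) ->
  exists d, pendant_vertex S v d z.
Proof.
move=> [[zS _] _ [zD _] DS Dcl] D0 vD min.
have single d : d \in D -> (forall e, e \in D -> e -- z -> (d -- z)) -> pendant_vertex S v d z.
  move=> dD adj; have dS := fintype.subsetP DS d dD.
  have Dd : D :\ d = finset.set0.
    apply/eqP; apply: contraT => Dd0.
    pose z' := if d -- z then z else d.
    have /min : attached S (D :\ d) z' d.
      split => //.
      - by rewrite /z'; case: ifP.
      - by rewrite /z'; case: ifP => [|_]; rewrite ?eqxx // edgeC => ->; rewrite orbT.
      - by rewrite !inE eqxx /z'; case: ifP; rewrite ?(negPf zD) ?andbF ?eqxx.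
      - by apply: (fintype.subset_trans _ DS); apply: finset.subsetDl.
      - move=> e u; rewrite !inE => /andP[ed eD] uS eu.
        have /or3P[uD|uz|uz] := Dcl e u eD uS eu; first by rewrite uD andbT; case: eqVneq; rewrite ?orbT.
        1,2: by rewrite /z' (adj e eD) ?uz ?orbT // -(eqP uz).
    by move=> /(_ Dd0 (finset.subsetDl _ _)); rewrite (cardsD1 d D) dD ltnn.
  split => // [|u uS du]; first by apply: contraNneq vD => <-.
  have /or3P[uD|/eqP//|/eqP//] := Dcl d u dD uS du.
  have : u \in D :\ d by rewrite !inE uD eq_sym (edge_neq du).
  by rewrite Dd inE.
have [/existsP[d /andP[dD dz]]|] := boolP [exists d, (d \in D) && (d -- z)].
  by exists d; apply: single.
rewrite negb_exists => /forallP nadj.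
have [d dD] := finset.set0Pn _ D0; exists d; apply: single => // e eD ez.
by have := nadj e; rewrite eD ez.
Qed.

Lemma girth_triangle g x y z : (forall k, has_cycle G k -> g <= k) -> 3 < g ->
  x -- y -> y -- z -> z -- x -> False.
Proof.
move=> girth g3 xy yz zx.
suff /girth : has_cycle G 3 by rewrite leqNgt g3.
exists [:: x; y; z]; split => //; rewrite /ucycle /= xy yz zx /= !inE.
by rewrite (negPf (edge_neq xy)) (negPf (edge_neq yz)) eq_sym (negPf (edge_neq zx)).
Qed.

(** If [z] and [z'] were distinct and not adjacent, [W] and the two open arcs of the cycle between
    them would be three disjoint blocks joining [z] to [z']. *)
Lemma attachments_adjacent (W : {set G}) c :
  K23_free G -> cycle (@edge G) c -> uniq c -> (forall u, u \in c -> u \notin W) ->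
  (forall u w, u \in W -> w \in W -> connect [rel u w | [&& u -- w, u \in W & w \in W]] u w) ->
  forall z z' d d', z \in c -> z' \in c -> d \in W -> d' \in W -> d -- z -> d' -- z' ->
  (z == z') || (z -- z').
Proof.
move=> free cyc unc cW Wc z z' d d' zc z'c dW d'W dz d'z'.
apply: contraT; rewrite negb_or => /andP[zz' nzz'].
have [i c' rc] := rot_to zc.
have {}z'c : z' \in z :: c' by rewrite -rc mem_rot.
have {}cyc : cycle (@edge G) (z :: c') by rewrite -rc rot_cycle.
have {}unc : uniq (z :: c') by rewrite -rc rot_uniq.
have {}cW u : u \in z :: c' -> u \notin W by rewrite -rc mem_rot; apply: cW.
move: z'c; rewrite inE eq_sym (negPf zz') /= => z'c.
case/splitPr: z'c cyc unc cW => s2 s3.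
rewrite /= rcons_path cat_path last_cat /= => /andP[/and3P[zs2 s2z' z's3] s3z] unc cW.
have [q1 dq1 ld'] := connectP (Wc d d' dW d'W).
have [dq1' q1W] := path_in dq1 dW.
(* In each block one walk runs through to its end and the other enters there with a single step. *)
pose P j := if j is j'.+1 then if j' is 0 then s2 else [:: last z' s3] else d :: q1.
pose Q j := if j is j'.+1 then if j' is 0 then [:: last z s2] else s3 else [:: d'].
pose B j := if j is j'.+1 then if j' is 0 then [set u in s2] else [set u in s3] else W.
have s20 : s2 != [::] by apply: contraNneq nzz' => s20; move: s2z'; rewrite s20.
have s30 : s3 != [::] by apply: contraNneq nzz' => s30; move: s3z; rewrite s30 edgeC.
have lasts2 : last z s2 \in s2 by case: (s2) s20 => //= a s _; apply: mem_last.
have lasts3 : last z' s3 \in s3 by case: (s3) s30 => //= a s _; apply: mem_last.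
move: unc; rewrite /= mem_cat inE !negb_or cat_uniq /= -!andbA.
move=> /and5P[zs2' _ zs3 _ /and3P[+ z's3' _]]; rewrite negb_or => /andP[z's2 s23].
case: (@K23_free_blocks z z' B P Q) => //.
- case=> [|[|[|//]]] _ /=; split => //.
  + by rewrite edgeC dz.
  + by rewrite edgeC d'z'.
  + by rewrite edgeC s2z'.
  + by rewrite edgeC s3z.
- by case=> [|[|[|//]]] _ /=; split => // u; rewrite !inE // => /eqP ->.
- case=> [|[|[|//]]] _ /=; rewrite ?inE //; split.
  + by apply: cW; rewrite mem_head.
  + by apply: cW; rewrite inE mem_cat mem_head !orbT.
have c2 u : u \in s2 -> u \notin W by move=> us; apply: cW; rewrite inE mem_cat us orbT.
have c3 u : u \in s3 -> u \notin W.
  by move=> us; apply: cW; rewrite inE mem_cat inE us !orbT.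
have c23 u : u \in s3 -> u \notin s2.
  by move=> us; apply: contra s23 => us2'; apply/hasP; exists u.
case=> [|[|[|//]]] [|[|[|//]]] u _ _ //=; rewrite ?inE => h h'.
- by move: (c2 _ h'); rewrite h.
- by move: (c3 _ h'); rewrite h.
- by move: (c2 _ h); rewrite h'.
- by move: (c23 _ h'); rewrite h.
- by move: (c3 _ h); rewrite h'.
- by move: (c23 _ h); rewrite h'.
Qed.

(** Let [D] be minimal. If both ends of an edge [x -- y] have neighbours in [D], a shortest path [p]
    from [x] to [y] through [D] exhausts [D] and has no chords; the edge closes it to a cycle, which
    bounds its length. Otherwise [attached_one_pendant] applies. *)
Lemma attached_reducible g S v D x y :
  K23_free G -> (forall k, has_cycle G k -> g <= k) -> 4 < g ->
  attached S D x y -> D != finset.set0 -> v \notin D ->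
  (exists d x', pendant_vertex S v d x') \/
  (exists x' y' p, pendant_path S v x' y' p /\ g <= (size p).+2).
Proof.
move=> free girth g5; have [n] := ubnP #|D|.
elim: n => // n IH in D x y *; rewrite ltnS => Dn att D0 vD.
have [[D' [x' [y' [att' D'0 D'D lt]]]]|nex] := pselect (exists D' x' y',
   [/\ attached S D' x' y', D' != finset.set0, D' \subset D & #|D'| < #|D|]).
  apply: (IH D' x' y') => //; first exact: leq_trans lt Dn.
  by apply: contraNN vD; apply: (fintype.subsetP D'D).
have min D' x' y' : attached S D' x' y' -> D' != finset.set0 -> D' \subset D -> #|D| <= #|D'|.
  move=> att' D'0 D'D; rewrite leqNgt; apply/negP => lt.
  by apply: nex; exists D', x', y'.
have one z : attached S D z z -> exists d x', pendant_vertex S v d x'.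
  move=> attz; have [d pd] := attached_one_pendant attz D0 vD min; by exists d, z.
have [[xS yS] xy [xD yD] DS Dcl] := att.
have [exy|nxy] := eqVneq x y.
  by left; apply: (one x); rewrite {2}exy.
have {}xy : x -- y by move: xy; rewrite (negPf nxy).
have [/existsP[dx /andP[dxD dxx]]|] := boolP [exists d, (d \in D) && (d -- x)]; last first.
  rewrite negb_exists => /forallP nadj; left; apply: (one y); split; rewrite ?eqxx //.
  move=> d u dD uS du; have /or3P[->//|/eqP ux|->] := Dcl d u dD uS du; last by rewrite /= orbT.
  by have := nadj d; rewrite dD -ux du.
have [/existsP[dy /andP[dyD dyy]]|] := boolP [exists d, (d \in D) && (d -- y)]; last first.
  rewrite negb_exists => /forallP nadj; left; apply: (one x); split; rewrite ?eqxx //.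
  move=> d u dD uS du; have /or3P[->//|->|/eqP uy] := Dcl d u dD uS du; first by rewrite /= orbT.
  by have := nadj d; rewrite dD -uy du.
(* By minimality [D] is the component of [dx], hence it contains a walk to [dy]. *)
have [q dxq dyE] : exists2 q, path [rel u w | [&& u -- w, u \in D & w \in D]] dx q & dy = last dx q.
  apply/connectP; have attD1 := attached_connected att dxD.
  set D1 := [set w in D | _] in attD1.
  have D1D : D1 \subset D by apply/fintype.subsetP => w; rewrite inE => /andP[].
  have D1dx : dx \in D1 by rewrite inE dxD connect0.
  have : D1 == D.
    rewrite eqEcard D1D; apply: min attD1 _ D1D.
    by apply/finset.set0Pn; exists dx.
  move=> /eqP E; have : dy \in D1 by rewrite E.
  by rewrite inE => /andP[].
have [dxq' qD] := path_in dxq dxD.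
have [|p [p0 up pD xpy pmin]] := @shortest_link x y D (dx :: q) isT qD.
  by rewrite rcons_cons /= rcons_path edgeC dxx dxq' -dyE dyy.
have xp : x \notin p by apply: contra xD => /pD.
have yp : y \notin p by apply: contra yD => /pD.
have uc : uniq (x :: rcons p y) by rewrite /= mem_rcons inE negb_or nxy xp rcons_uniq yp.
have cyc : cycle (@edge G) (x :: rcons p y) by rewrite /= rcons_path xpy last_rcons edgeC.
have cS u : u \in x :: rcons p y -> u \in S.
  rewrite inE mem_rcons inE => /or3P[/eqP->|/eqP->|/pD] //; exact: (fintype.subsetP DS).
(* A component [W] of [D] off [p] has pairwise adjacent attachments on the cycle. The girth excludes
   three of them, so [W] is attached to at most a vertex or an edge, against minimality. *)
have Dp u : u \in D -> u \in p.
  move=> uD; apply: contraT => up'.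
  pose D2 := [set w in D | w \notin p].
  pose W := [set w in D2 | connect [rel u w | [&& u -- w, u \in D2 & w \in D2]] u w].
  have WD2 w : w \in W -> w \in D2 by rewrite inE => /andP[].
  have WD : W \subset D by apply/fintype.subsetP => w /WD2; rewrite inE => /andP[].
  have uW : u \in W by rewrite !inE uD up' connect0.
  have W0 : W != finset.set0 by apply/finset.set0Pn; exists u.
  have Wcl d w : d \in W -> w \in S -> d -- w -> (w \in W) || (w \in x :: rcons p y).
    move=> dW wS dw; have dD := fintype.subsetP WD d dW.
    rewrite [w \in _ :: _]inE mem_rcons inE.
    have /or3P[wD|->|->] := Dcl d w dD wS dw; rewrite ?orbT //.
    have [wp|wp] := boolP (w \in p); first by rewrite !orbT.
    have dD2 := WD2 d dW; have wD2 : w \in D2 by rewrite inE wD.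
    rewrite inE wD2 (connect_trans (y := d)) //; first by move: dW; rewrite inE => /andP[].
    by rewrite connect1 //= dw dD2.
  have cW w : w \in x :: rcons p y -> w \notin W.
    move=> wc; apply/negP => /WD2; rewrite inE => /andP[wD wp]; move: wc.
    rewrite inE mem_rcons inE (negPf wp) orbF => /orP[]/eqP wE; move: wD.
      by rewrite wE (negPf xD).
    by rewrite wE (negPf yD).
  have Wc w w' : w \in W -> w' \in W ->
      connect [rel u w | [&& u -- w, u \in W & w \in W]] w w'.
    have reachW t : t \in W -> connect [rel u w | [&& u -- w, u \in W & w \in W]] u t.
      rewrite inE => /andP[tD2 /connectP[r ur ->]]; move: {tD2 t} ur.
      elim/last_ind: r => [|r t IHr]; first by rewrite connect0.
      rewrite rcons_path last_rcons => /andP[ur /and3P[rt rD2 tD2]].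
      have rW : last u r \in W by rewrite inE rD2; apply/connectP; exists r.
      apply: connect_trans (IHr ur) (connect1 _); rewrite /= rt rW.
      rewrite inE tD2; apply/connectP; exists (rcons r t); last by rewrite last_rcons.
      by rewrite rcons_path ur /= rt rD2.
    move=> wW w'W; apply: connect_trans (reachW _ w'W).
    rewrite sym_connect_sym ?reachW // => a b /=.
    by rewrite edgeC; case: (a \in W); rewrite ?andbF ?andbT.
  have adj := attachments_adjacent free cyc uc cW Wc.
  pose A := [set z in x :: rcons p y | [exists d, (d \in W) && (d -- z)]].
  have AP z : reflect (z \in x :: rcons p y /\ exists2 d, d \in W & d -- z) (z \in A).
    rewrite finset.in_set; apply: (iffP andP) => -[zc].
      by move=> /existsP[d /andP[dW dz]]; split => //; exists d.
    by move=> [d dW dz]; split => //; apply/existsP; exists d; rewrite dW.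
  have adjA z z' : z \in A -> z' \in A -> (z == z') || (z -- z').
    by move=> /AP[zc [d dW dz]] /AP[z'c [d' d'W d'z']]; apply: adj dW d'W dz d'z'.
  have [z [z' [zc z'c zz' Azz']]] : exists z z', [/\ z \in x :: rcons p y,
      z' \in x :: rcons p y, (z == z') || (z -- z') & forall w, w \in A -> (w == z) || (w == z')].
    have [A0|[z zA]] := finset.set_0Vmem A.
      exists x, x; split; rewrite ?mem_head ?eqxx // => w; by rewrite A0 inE.
    have zc : z \in x :: rcons p y by case/AP: zA.
    have [/existsP[z' /andP[z'A z'z]]|] := boolP [exists z', (z' \in A) && (z' != z)].
      have zz' : z -- z' by have := adjA _ _ zA z'A; rewrite eq_sym (negPf z'z).
      exists z, z'; split => //; first by case/AP: z'A.
        by rewrite zz' orbT.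
      move=> w wA; apply: contraT; rewrite negb_or => /andP[wz wz'].
      have := adjA _ _ wA zA; rewrite (negPf wz) => /= wz1.
      have := adjA _ _ z'A wA; rewrite eq_sym (negPf wz') => /= wz2.
      by case: (girth_triangle girth (ltnW g5) zz' wz2 wz1).
    rewrite negb_exists => /forallP nex2; exists z, z; split; rewrite ?eqxx // => w wA.
    by have := nex2 w; rewrite wA /= negbK orbb.
  have attW : attached S W z z'.
    split => //; first by split; apply: cS.
    - by split; apply: cW.
    - exact: fintype.subset_trans WD DS.
    - move=> d w dW wS dw; have /orP[->//|wc] := Wcl d w dW wS dw.
      have /Azz' : w \in A by apply/AP; split => //; exists d.
      by case/orP => ->; rewrite ?orbT.
  (* [W] misses the first vertex of [p], so it is strictly smaller than [D]. *)
  have := min W z z' attW W0 WD; rewrite leqNgt proper_card // properE WD.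
  apply/fintype.subsetPn; case: (p) p0 pD cW => [|h t]; first by rewrite eqxx.
  move=> _ pD cW; exists h; first by apply: pD; rewrite mem_head.
  by apply: cW; rewrite rcons_cons !inE eqxx orbT.
right; exists x, y, p; split; last first.
  have /girth : has_cycle G (size (x :: rcons p y)).
    exists (x :: rcons p y); split => //; first by rewrite /ucycle cyc.
    by rewrite /= size_rcons !ltnS lt0n size_eq0.
  by rewrite /= size_rcons.
split => //; first by split => //; apply: contra vD => /pD.
  by move=> u /pD /(fintype.subsetP DS).
move=> p1 u p2 pE w wS uw.
have uD : u \in D by apply: pD; rewrite pE mem_cat mem_head orbT.
have shorter q' : q' != [::] -> {subset q' <= p} -> path (@edge G) x (rcons q' y) ->
    size q' < size p -> False.
  by move=> q0 q'p xq'; rewrite ltnNge pmin // => t /q'p /pD.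
move: (xpy); rewrite pE rcons_cat cat_path rcons_cons /= => /and3P[xp1 p1u up2].
have : [|| w \in p1, w \in p2, w == x | w == y].
  have /or3P[/Dp|->|->] := Dcl u w uD wS uw; rewrite ?orbT //.
  rewrite pE mem_cat inE => /or3P[->//|/eqP wu|->]; rewrite ?orbT //.
  by move: uw; rewrite wu edge_irr.
(* A neighbour elsewhere gives a shortcut. Each shortcut retains [u], so it is nonempty and competes
   with [p]. *)
case/or4P => [wp1|wp2|/eqP wx|/eqP wy].
- move: wp1 pE xp1 p1u; case/splitPr => a b pE; rewrite cat_path last_cat /=.
  case: b pE => [|b0 b] pE; first by left.
  move=> /and3P[xa aw _] _; exfalso; apply: (shorter (a ++ w :: u :: p2)).
  + by case: (a).
  + move=> t; rewrite pE !(mem_cat, inE) => /or4P[]->; rewrite ?orbT //.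
  + by rewrite rcons_cat cat_path /= xa aw edgeC uw.
  + by rewrite pE !(size_cat, size_rcons) /= ?size_cat /=; clear; lia.
- move: wp2 pE up2; case/splitPr => a b pE; rewrite rcons_cat cat_path /=.
  case: a pE => [|a0 a] pE; first by right.
  move=> /and3P[_ _ wb]; exfalso; apply: (shorter (p1 ++ u :: w :: b)).
  + by case: (p1).
  + move=> t; rewrite pE !(mem_cat, inE) => /or4P[]->; rewrite ?orbT //.
  + by rewrite rcons_cat cat_path /= xp1 p1u uw wb.
  + by rewrite pE !(size_cat, size_rcons) /= ?size_cat /=; clear; lia.
- case: p1 pE xp1 p1u => [|h t] pE xp1 p1u; first by left.
  exfalso; apply: (shorter (u :: p2)) => //.
  + by move=> r rp; rewrite pE mem_cat rp orbT.
  + by rewrite rcons_cons /= up2 -wx edgeC uw.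
  + by rewrite pE size_cat /=; clear; lia.
- case: p2 pE up2 => [|h t] pE up2; first by right.
  exfalso; apply: (shorter (rcons p1 u)) => //.
  + by case: (p1).
  + by move=> r; rewrite mem_rcons inE pE mem_cat inE => /orP[->|->]; rewrite ?orbT.
  + by rewrite !rcons_path xp1 p1u last_rcons -wy uw.
  + by rewrite pE size_cat size_rcons /=; clear; lia.
Qed.

(** All of [S] except [v] is attached to [v], which starts the descent to a minimal set. *)
Lemma K23_free_reducible g S v :
  K23_free G -> (forall k, has_cycle G k -> g <= k) -> 4 < g ->
  v \in S -> 1 < #|S| ->
  (exists d x, pendant_vertex S v d x) \/
  (exists x y p, pendant_path S v x y p /\ g <= (size p).+2).
Proof.
move=> free girth g5 vS S1.
apply: (@attached_reducible g S v (S :\ v) v v) => //.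
- split; rewrite ?eqxx //.
  + by rewrite !inE eqxx.
  + exact: finset.subsetDl.
  + by move=> d u _ uS _; rewrite !inE uS andbT; case: eqVneq.
- by rewrite -card_gt0; move: S1; rewrite (cardsD1 v) vS.
- by rewrite !inE eqxx.
Qed.

End Structure.

(** * Colouring paths and cycles *)

Section Colouring.
Local Open Scope nat_scope.
Local Open Scope fset_scope.
Implicit Types (a b c k m : nat) (U X Y F l : {fset int}) (ls cs : seq {fset int}).

Lemma fresh_family U a : exists F : nat -> {fset int},
  [/\ forall i, #|` F i| = a, forall i, fdisjoint (F i) U &
      forall i j, i != j -> fdisjoint (F i) (F j)].
Proof.
(* Elements of [U] have absolute value below [N], so the consecutive intervals of length [a] from
   [N] on are fresh. *)
pose N := (\sum_(u <- U) absz u).+1.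
pose s i := [seq Posz (N + i * a + j) | j <- iota 0 a].
exists (fun i => [fset x in s i]).
have inF i x : x \in [fset x in s i] -> exists2 j, j < a & x = Posz (N + i * a + j).
  by rewrite inE /= => /mapP[j]; rewrite mem_iota => /andP[_ ja] ->; exists j.
split=> [i|i|i j ij].
- rewrite card_fseq undup_id ?size_map ?size_iota // map_inj_uniq ?iota_uniq // => x y.
  by move=> [] /addnI.
- apply/fdisjointP => x /inF[j ja ->]; apply/negP => xU.
  have : absz (Posz (N + i * a + j)) < N.
    by rewrite ltnS (big_fsetD1 _ xU) /= leq_addr.
  by rewrite /= -addnA ltnNge leq_addr.
- apply/fdisjointP => x /inF[j1 j1a ->]; apply/negP => /inF[j2 j2a] [].
  rewrite -!addnA => /addnI e; move/negP: ij; apply; apply/eqP.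
  have a0 : 0 < a by case: (a) j1a.
  by move: (congr1 (divn^~ a) e); rewrite !divnMDl // !divn_small // !addn0.
Qed.

Lemma fset_take F m : m <= #|` F| ->
  exists A : {fset int}, [/\ A `<=` F, #|` A| = m & A = [fset x in take m F]].
Proof.
move=> mF; exists [fset x in take m F]; split => //.
  by apply/fsubsetP => x; rewrite inE /= => /mem_take.
by rewrite card_fseq undup_id ?size_takel // take_uniq // fset_uniq.
Qed.

Definition few c : rel {fset int} := [rel A B | #|` A `&` B| <= c].
Definition apart : rel {fset int} := [rel A B | fdisjoint A B].

Lemma few_sym c : symmetric (few c).
Proof. by move=> A B; rewrite /few /= fsetIC. Qed.

(* The colours of X in the first list and those of Y in the last one are replaced by
   elements of a common fresh set F, the list of the vertex closing the cycle. *)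
Lemma cycle_path_extends a b c n X Y ls : 2 < n -> b <= a ->
  free_choosable (cycle_graph n.+1) a b c ->
  size ls = n -> all (fun l => #|` l| == a) ls ->
  #|` X| <= b -> #|` Y| <= b -> path (few c) X (rcons ls Y) ->
  exists cs, [/\ size cs = size ls,
    forall i, i < size ls -> nth fset0 cs i `<=` nth fset0 ls i /\ #|` nth fset0 cs i| = b &
    path apart X (rcons cs Y)].
Proof.
move=> n3 ba free szls als Xb Yb fewls.
pose lst i := nth fset0 ls i.
have lsta i : i < n -> #|` lst i| = a.
  by move=> im; apply/eqP; apply: (allP als); rewrite mem_nth ?szls.
have fewX : #|` X `&` lst 0| <= c.
  by have := pathP fset0 fewls 0; rewrite size_rcons szls /= nth_rcons szls (ltnW (ltnW n3)); apply.
have fewY : #|` Y `&` lst n.-1| <= c.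
  have := pathP fset0 fewls n; rewrite size_rcons szls => /(_ (ltnSn n)).
  case: (n) szls n3 => [//|n' szls _] /=.
  by rewrite !nth_rcons szls ltnSn ltnn eqxx fsetIC.
have fewL i : i.+1 < n -> #|` lst i `&` lst i.+1| <= c.
  move=> i1; have := pathP fset0 fewls i.+1; rewrite size_rcons szls /=.
  by rewrite !nth_rcons szls i1 (ltnW i1) => /(_ _); apply; rewrite ltnS ltnW // ltnW.
pose U := \bigcup_(l <- ls) l.
have [F0 [F0a F0U _]] := fresh_family U a; pose F := F0 0.
have Fa : #|` F| = a := F0a 0.
have Flst i x : i < n -> x \in lst i -> x \notin F.
  move=> im xl; apply: contraL (F0U 0) => xF; apply/negP => /fdisjointP /(_ x xF).
  by move/negP; apply; apply/bigfcupP; exists (lst i); rewrite ?mem_nth ?szls.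
have [C [CF Cb CE]] := @fset_take F b ltac:(by rewrite Fa).
have sub_take m : m <= b -> exists2 A, A `<=` C & #|` A| = m.
  by move=> mb; have [|A [AC Am _]] := @fset_take C m; rewrite ?Cb //; exists A.
(* [A] and [B] replace the colours forbidden at the two ends. They fit into [C] because [X] and [Y]
   have at most [b] colours, and they may overlap. *)
have [A AC Ac] : exists2 A, A `<=` C & #|` A| = #|` X `&` lst 0|.
  by apply: sub_take; apply: leq_trans Xb; apply: fsubset_leq_card; apply: fsubsetIl.
have [B BC Bc] : exists2 B, B `<=` C & #|` B| = #|` Y `&` lst n.-1|.
  by apply: sub_take; apply: leq_trans Yb; apply: fsubset_leq_card; apply: fsubsetIl.
have disjF D D' (DF : D `<=` C) (lD' : forall x, x \in D' -> x \notin F) : D `&` D' = fset0.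
  apply/fsetP => x; rewrite !inE; apply/andP => -[/(fsubsetP DF)/(fsubsetP CF) xF /lD'].
  by rewrite xF.
pose new i := if i == 0 then A `|` (lst i `\` X)
  else if i == n.-1 then B `|` (lst i `\` Y) else lst i.
have new_card i : i < n -> #|` new i| = a.
  move=> im; rewrite /new; case: eqVneq => [->|_].
    rewrite cardfsU disjF ?cardfs0 ?subn0 // => [|x]; last first.
      by rewrite inE => /andP[_ /Flst]; apply; rewrite ltnW // ltnW.
    rewrite Ac cardfsD [X `&` _]fsetIC subnKC; last exact: fsubset_leq_card (fsubsetIl _ _).
    by rewrite lsta // ltnW // ltnW.
  case: eqVneq => [iE|_]; last exact: lsta.
  rewrite iE in im *; rewrite cardfsU disjF ?cardfs0 ?subn0 // => [|x]; last first.
    by rewrite inE => /andP[_ /Flst]; apply.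
  rewrite Bc cardfsD [Y `&` _]fsetIC subnKC; last exact: fsubset_leq_card (fsubsetIl _ _).
  exact: lsta.
have new_sub i x : x \in new i -> x \in lst i \/ x \in F /\ (i == 0) || (i == n.-1).
  rewrite /new; case: eqVneq => [->|_].
    by rewrite !inE => /orP[/(fsubsetP AC)/(fsubsetP CF) xF|/andP[_ xl]]; [right|left].
  case: eqVneq => [->|_]; last by left.
  rewrite !inE => /orP[/(fsubsetP BC)/(fsubsetP CF) xF|/andP[_ xl]]; last by left.
  by right; rewrite orbT.
have newX x : x \in new 0 -> x \notin C -> x \in lst 0 /\ x \notin X.
  rewrite /new eqxx !inE => /orP[/(fsubsetP AC)->//|/andP[xX xl] _]; by split.
have npos : 0 < n := ltnW (ltnW n3).
have nn : n.-1 < n by rewrite prednK.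
have n0 : n.-1 != 0 by rewrite -lt0n -ltnS prednK // ltnW.
have newY x : x \in new n.-1 -> x \notin C -> x \in lst n.-1 /\ x \notin Y.
  rewrite /new (negPf n0) eqxx !inE => /orP[/(fsubsetP BC)->//|/andP[xY xl] _]; by split.
(* Vertex 0 of the cycle is the closing vertex with list [F]; vertex [k.+1] takes the modified list
   of position [k] of the path. *)
pose Ln k := if k is k'.+1 then new k' else F.
have FX : F `&` new 0 `<=` A.
  apply/fsubsetP => x; rewrite /new eqxx !inE => /andP[xF /orP[//|/andP[_ xl]]].
  by have := Flst 0 x (ltnW (ltnW n3)) xl; rewrite xF.
have FY : new n.-1 `&` F `<=` B.
  apply/fsubsetP => x; rewrite /new (negPf n0) eqxx !inE => /andP[/orP[//|/andP[_ xl]] xF].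
  by have := Flst n.-1 x nn xl; rewrite xF.
(* Colours of [F] occur only in [new 0] and [new n.-1], which are not consecutive because
   [2 < n]. *)
have new_few k : k.+1 < n -> new k `&` new k.+1 `<=` lst k `&` lst k.+1.
  move=> kn; apply/fsubsetP => x; rewrite !inE => /andP[/new_sub h1 /new_sub h2].
  have k1 := ltnW kn.
  case: h1 => [xl|[xF]].
    rewrite xl; case: h2 => // -[xF _]; by have := Flst k x k1 xl; rewrite xF.
  have -> /= : (k == n.-1) = false by apply/negP => /eqP kE; move: kn; rewrite kE prednK // ltnn.
  rewrite orbF => /eqP k0; case: h2 => [xl|[_]]; first by have := Flst _ x kn xl; rewrite xF.
  by rewrite k0 /= => /eqP nE; move: n3; rewrite -[n]prednK // -nE.
pose L (i : cycle_graph n.+1) := Ln (nat_of_ord i).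
have LS (i : 'I_n.+1) : #|` Ln i `&` Ln (ordS i)| <= c.
  case: i => -[|k] kn /=; first by rewrite modn_small ?ltnS ?(ltnW (ltnW n3)) //=;
    apply: leq_trans fewX; rewrite -Ac; apply: fsubset_leq_card.
  have [kE|kn1] := eqVneq k.+1 n.
    rewrite kE modnn /= (_ : k = n.-1); last by rewrite -kE.
    by apply: leq_trans fewY; rewrite -Bc; apply: fsubset_leq_card.
  have kn2 : k.+1 < n by rewrite ltn_neqAle kn1.
  rewrite modn_small ?ltnS //=.
  by apply: leq_trans (fewL k kn2); apply: fsubset_leq_card; apply: new_few.
have La : list_assignment a L.
  by case=> -[|k] kn; rewrite /L /= ?Fa // new_card.
have Lc : separating c L.
  move=> u v /andP[_ /orP[]/eqP->]; first exact: LS.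
  by rewrite fsetIC; apply: LS.
have [phi [[phiL phid] phi0]] := free L La Lc ord0 C CF Cb.
have edgeS (i : 'I_n.+1) : @edge (cycle_graph n.+1) i (ordS i).
  apply/andP; split; last by rewrite eqxx.
  apply/eqP => /(congr1 (@nat_of_ord _)) /=.
  case: i => k kn /=; have [kE|kn1] := eqVneq k n.
    by rewrite kE modnn => n0'; move: n3; rewrite n0'.
  by rewrite modn_small; [move/n_Sn|rewrite ltnS ltn_neqAle kn1].
have i1 i : i < n -> (inord i.+1 : 'I_n.+1) = i.+1 :> nat by move=> im; rewrite inordK.
pose col i := phi (inord i.+1).
have colE i : i < n -> col i `<=` new i.
  by move=> im; have [] := phiL (inord i.+1); rewrite /L i1.
have col_apart i : i.+1 < n -> fdisjoint (col i) (col i.+1).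
  move=> im; have := phid _ _ (edgeS (inord i.+1)).
  rewrite (_ : ordS _ = inord i.+2) => [h|]; first by rewrite /fdisjoint h.
  by apply/val_inj; rewrite /= i1 ?(ltnW im) // inordK // modn_small.
have first_apart x : x \in col 0 -> x \notin C.
  have := phid _ _ (edgeS ord0); rewrite (_ : ordS _ = inord 1) => [|]; last first.
    by apply/val_inj; rewrite /= inordK // modn_small.
  by rewrite phi0 => /fsetP h xc; apply/negP => xC; have := h x; rewrite !inE xC xc.
have last_apart x : x \in col n.-1 -> x \notin C.
  have := phid _ _ (edgeS (inord n)); rewrite (_ : ordS _ = ord0) => [|]; last first.
    by apply/val_inj; rewrite /= inordK // modnn.
  rewrite phi0 /col prednK // => /fsetP h xc; apply/negP => xC; have := h x.
  by rewrite !inE xC xc.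
(* The ends avoid [C], the colour set of vertex 0, so they use no replacement colours; only old ones
   outside [X], respectively [Y], are left. *)
have col_first x : x \in col 0 -> x \in lst 0 /\ x \notin X.
  by move=> xc; apply: newX; [apply: (fsubsetP (colE 0 npos))|apply: first_apart].
have col_last x : x \in col n.-1 -> x \in lst n.-1 /\ x \notin Y.
  by move=> xc; apply: newY; [apply: (fsubsetP (colE _ nn))|apply: last_apart].
have col_lst i : i < n -> col i `<=` lst i.
  move=> im; apply/fsubsetP => x; have [->|i0] := eqVneq i 0; first by case/col_first.
  have [->|i1'] := eqVneq i n.-1; first by case/col_last.
  by move/(fsubsetP (colE i im)); rewrite /new (negPf i0) (negPf i1').
exists (mkseq col n); split; rewrite ?size_mkseq ?szls //.
  move=> i im; rewrite nth_mkseq //; split; first exact: col_lst.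
  by have [] := phiL (inord i.+1).
apply/(pathP fset0) => i; rewrite size_rcons size_mkseq ltnS => im.
rewrite nth_rcons size_mkseq; case: i im => [|i] im /=.
  rewrite npos nth_mkseq //; apply/fdisjointP => x xX; apply/negP => /col_first[_].
  by rewrite xX.
rewrite nth_rcons size_mkseq im nth_mkseq //; have [iE|i1n] := eqVneq i.+1 n.
  rewrite iE ltnn; apply/fdisjointP => x; rewrite (_ : i = n.-1); last by rewrite -iE.
  by case/col_last.
have i2 : i.+1 < n by rewrite ltn_neqAle i1n.
by rewrite i2 nth_mkseq //; apply: col_apart.
Qed.

(** [l] is made the first list of a path whose other [n.-1] lists are fresh and whose far end is
    unconstrained. *)
Lemma cycle_greedy a b c n X l : 2 < n -> b <= a ->
  free_choosable (cycle_graph n.+1) a b c ->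
  #|` l| = a -> #|` X| <= b -> few c X l ->
  exists A, [/\ A `<=` l, #|` A| = b & fdisjoint X A].
Proof.
move=> n3 ba free la Xb Xl.
have [F [Fa Fl FF]] := fresh_family l a.
have npos : 0 < n := ltnW (ltnW n3).
pose ls := l :: mkseq F n.-1.
have szls : size ls = n by rewrite /= size_mkseq prednK.
have fewls : path (few c) X (rcons ls fset0).
  rewrite /= Xl /= rcons_path; apply/andP; split; last by rewrite /few /= fsetI0 cardfs0.
  apply/(pathP fset0) => i; rewrite size_mkseq => im.
  rewrite /few /= nth_mkseq //; case: i im => [|i] im /=.
    by have /eqP := Fl 0; rewrite fsetIC => ->; rewrite cardfs0.
  rewrite nth_mkseq ?(ltnW im) //.
  by have /eqP -> := FF i i.+1 (negbT (ltn_eqF (ltnSn i))); rewrite cardfs0.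
have [||cs [szcs csl apX]] := cycle_path_extends n3 ba free szls _ Xb _ fewls.
- rewrite /= la eqxx; apply/allP => _ /mapP[i _ ->]; by rewrite Fa.
- by rewrite cardfs0.
have [|Al Ab] := csl 0; first by rewrite szls.
exists (nth fset0 cs 0); split => //.
by case: cs szcs apX {csl Al Ab} => [//|A cs] _ /= /andP[].
Qed.

(** The first [m] vertices are coloured greedily; as a subset of [l], the chosen [A] inherits
    [few c] towards the next list. *)
Lemma cycle_path_extends_long a b c n m X Y ls : 2 < n -> b <= a ->
  free_choosable (cycle_graph n.+1) a b c ->
  size ls = (m + n)%N -> all (fun l => #|` l| == a) ls ->
  #|` X| <= b -> #|` Y| <= b -> path (few c) X (rcons ls Y) ->
  exists cs, [/\ size cs = size ls,
    forall i, i < size ls -> nth fset0 cs i `<=` nth fset0 ls i /\ #|` nth fset0 cs i| = b &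
    path apart X (rcons cs Y)].
Proof.
move=> n3 ba free; elim: m X ls => [|m IH] X ls szls als Xb Yb fewls.
  exact: cycle_path_extends n3 ba free szls als Xb Yb fewls.
case: ls szls als fewls => [//|l ls] [szls] /= /andP[/eqP la als] /andP[Xl fewls].
have [A [Al Ab XA]] := cycle_greedy n3 ba free la Xb Xl.
have fewA : path (few c) A (rcons ls Y).
  case: (ls) fewls => [|l' ls'] /= /andP[ll' ls'Y]; apply/andP; split => //.
    by apply: leq_trans ll'; apply: fsubset_leq_card; apply: fsetSI.
  by apply: leq_trans ll'; apply: fsubset_leq_card; apply: fsetSI.
have [|cs [szcs csl apA]] := IH A ls szls als _ Yb fewA; first by rewrite Ab.
exists (A :: cs); split; rewrite /= ?szcs //; first by case=> [|i] //=; apply: csl.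
by apply/andP.
Qed.

(** Induction on the size of a vertex set [S] containing [v]: a reducible configuration avoiding [v]
    is deleted, and it is coloured after the rest. *)
Lemma free_choosable_K23_free (G : sgraph) g a b c :
  K23_free G -> (forall k, has_cycle G k -> g <= k) -> 4 < g -> b <= a ->
  free_choosable (cycle_graph g.-1) a b c -> free_choosable G a b c.
Proof.
move=> free girth g5 ba cyc L La Lc v C CL Cb.
pose good (S : {set G}) (phi : G -> {fset int}) :=
  [/\ forall u, u \in S -> phi u `<=` L u /\ #|` phi u| = b,
      forall u w, u \in S -> w \in S -> edge u w -> fdisjoint (phi u) (phi w) &
      phi v = C].
(* C_{g-1} consists of a path of [g.-2] vertices and one closing vertex. *)
have n3 : 2 < g.-2 by clear - g5; lia.
have gE : g.-1 = g.-2.+1 by clear - g5; lia.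
rewrite gE in cyc.
suff [phi [phiL phid phiv]] : exists phi, good [set: G]%SET phi.
  exists phi; split => //; split => [u|u w uw]; first by apply: phiL; rewrite finset.in_setT.
  by apply/eqP; apply: phid; rewrite ?finset.in_setT.
suff all_good n (S : {set G}) : #|S| <= n -> v \in S -> exists phi, good S phi.
  by apply: (all_good #|[set: G]%SET|); rewrite ?finset.in_setT.
elim: n S => [|n IH] S Sn vS.
  by move: Sn; rewrite leqn0 cards_eq0 => /eqP S0; rewrite S0 finset.in_set0 in vS.
have [S1|S1] := leqP #|S| 1.
  have /eqP SE : S == [set v]%SET.
    by rewrite eq_sym eqEcard finset.sub1set vS cards1.
  exists (fun=> C); split => // [u|u w].
    by rewrite SE finset.in_set1 => /eqP ->.
  by rewrite SE !finset.in_set1 => /eqP -> /eqP ->; rewrite edge_irr.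
have fewL u w (A : {fset int}) : A `<=` L u -> edge u w -> few c A (L w).
  by move=> Au uw; apply: leq_trans (Lc u w uw); apply: fsubset_leq_card; apply: fsetSI.
have [[d [x [dS dv dx]]]|[x [y [p [pp gp]]]]] := K23_free_reducible free girth g5 vS S1.
  have [||phi [phiL phid phiv]] := IH (S :\ d)%SET.
  - by move: Sn; rewrite (cardsD1 d S) dS.
  - by rewrite !finset.inE vS eq_sym dv.
  have [A [Al Ab dA]] : exists A, [/\ A `<=` L d, #|` A| = b &
      forall u, u \in S -> edge d u -> fdisjoint (phi u) A].
    have [/andP[xS xd]|nx] := boolP ((x \in S) && edge d x).
      have xSd : x \in (S :\ d)%SET by rewrite !finset.inE xS eq_sym (edge_neq xd).
      have [px pxb] := phiL x xSd.
      have [||A [Al Ab xA]] := cycle_greedy (X := phi x) n3 ba cyc (La d).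
      - by rewrite pxb.
      - by apply: (fewL x) => //; rewrite edge_sym.
      by exists A; split => // u uS du; rewrite (dx u uS du).
    (* Here [d] has no neighbour in [S], so nothing is forbidden. *)
    have [|A [Al Ab xA]] := cycle_greedy (X := fset0) n3 ba cyc (La d) (leq0n _).
      by rewrite /few /= fset0I cardfs0.
    exists A; split => // u uS du; move: nx; rewrite -(dx u uS du) uS du //.
  exists (fun u => if u == d then A else phi u); split.
  - move=> u uS; case: eqVneq => [->//|ud]; by apply: phiL; rewrite !finset.inE ud.
  - move=> u w uS wS uw; case: eqVneq => [ud|ud]; case: eqVneq => [wd|wd].
    + by move: uw; rewrite ud wd edge_irr.
    + by rewrite fdisjoint_sym; apply: dA => //; rewrite -ud.
    + by apply: dA => //; rewrite -wd edge_sym.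
    + by apply: phid; rewrite // !finset.inE ?ud ?wd.
  - by rewrite eq_sym (negPf dv).
case: pp => [[xS yS] [up vp xp yp] pS xpy pnb].
pose S' := [set u in S | u \notin p]%SET.
have S'P u : (u \in S') = (u \in S) && (u \notin p) by rewrite finset.in_set.
have p0 : 0 < size p by move: g5 gp; case: (size p) => // g5 /(leq_trans g5).
have [||phi [phiL phid phiv]] := IH S'.
- rewrite -ltnS; apply: leq_trans Sn; apply: proper_card; apply/properP; split.
    by apply/fintype.subsetP => u; rewrite S'P => /andP[].
  have [h hp] : exists h, h \in p by case: (p) p0 => // h t _; exists h; rewrite mem_head.
  by exists h; [apply: pS|rewrite S'P hp andbF].
- by rewrite S'P vS.
have [xL xb] := phiL x ltac:(by rewrite S'P xS).
have [yL yb] := phiL y ltac:(by rewrite S'P yS).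
(* [g <= (size p).+2] gives [p] at least [g.-2] vertices; the surplus is the greedy part. *)
have szp : size (map L p) = (size p - g.-2 + g.-2)%N.
  by rewrite size_map; clear - gp; lia.
have [||||cs [szcs csL apcs]] :=
    cycle_path_extends_long (X := phi x) (Y := phi y) n3 ba cyc szp.
- by apply/allP => _ /mapP[u _ ->]; rewrite La.
- by rewrite xb.
- by rewrite yb.
- case: (p) p0 xpy => // h t _.
  rewrite /= => /andP[xh ht]; rewrite (fewL x) //=.
  elim: t h {xh} ht => [|h' t IHt] h /= /andP[hh' ht].
    by rewrite andbT few_sym (fewL y) // edge_sym.
  by rewrite (fewL h) ?fsubset_refl //=; apply: IHt.
pose psi u := if u \in p then nth fset0 cs (index u p) else phi u.
have psip : map psi p = cs.
  apply: (@eq_from_nth _ fset0); rewrite size_map; first by rewrite szcs size_map.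
  move=> i ip; rewrite (nth_map x) // /psi mem_nth // index_uniq //.
have psiN u : u \notin p -> psi u = phi u by rewrite /psi => /negPf ->.
have pathpsi : path (relpre psi apart) x (rcons p y).
  by rewrite -path_map map_rcons psip !psiN.
have psid u w : u \in p -> w \in S -> edge u w -> fdisjoint (psi u) (psi w).
  move=> up' wS uw.
  case/path.splitPr: up' pnb pathpsi {szp psip psiN szcs csL apcs} => p1 p2 /(_ p1 u p2 erefl w wS uw).
  move=> nb; rewrite rcons_cat cat_path /= => /and3P[_ lastu up2].
  case: nb => ->; first by rewrite fdisjoint_sym.
  by case: (p2) up2 => [|h t] /= /andP[].
exists psi; split.
- move=> u uS; have [up'|up'] := boolP (u \in p).
    rewrite /psi up'; have [|h1 h2] := csL (index u p); first by rewrite size_map index_mem.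
    by split => //; move: h1; rewrite (nth_map x) ?index_mem // nth_index.
  by rewrite psiN //; apply: phiL; rewrite S'P uS.
- move=> u w uS wS uw; have [up'|up'] := boolP (u \in p); first exact: psid.
  have [wp|wp] := boolP (w \in p); first by rewrite fdisjoint_sym; apply: psid; rewrite // edge_sym.
  by rewrite !psiN //; apply: phid; rewrite ?S'P ?uS ?wS.
- by rewrite psiN.
Qed.

(** * Upper bound: extending lists from a shortest cycle *)

Lemma shortest_cycle_chordless (G : sgraph) (s : seq G) u w :
  ucycle (@edge G) s -> (forall k, has_cycle G k -> size s <= k) ->
  u \in s -> w \in s -> edge u w -> w = next s u \/ u = next s w.
Proof.
move=> /andP[cyc us] short us' ws uw.
have [i s' rs] := rot_to us'.
have nextE := next_rot i us; rewrite rs in nextE.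
have cyc' : cycle (@edge G) (u :: s') by rewrite -rs rot_cycle.
have us2 : uniq (u :: s') by rewrite -rs rot_uniq.
have szs : size s = size (u :: s') by rewrite -rs size_rot.
have : w \in u :: s' by rewrite -rs mem_rot.
rewrite inE eq_sym (negPf (edge_neq uw)) /= => ws'.
move: nextE cyc' us2 szs; case/path.splitPr: ws' => s2 s3 nextE cyc' us2 szs.
case: s2 nextE cyc' us2 szs => [|a s2] nextE cyc' us2 szs.
  by left; rewrite -nextE /= eqxx.
case: s3 nextE cyc' us2 szs => [|e s3] nextE cyc' us2 szs.
  right; rewrite -nextE; rewrite -(next_rotr 1 us2) cats1 -rcons_cons rotr1_rcons /= eqxx //.
(* With vertices on both sides, the chord closes the part up to [w] to a cycle that misses
   [e :: s3]. *)
have /short : has_cycle G (size (u :: rcons (a :: s2) w)).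
  exists (u :: rcons (a :: s2) w); split => //; last by rewrite /= size_rcons.
  rewrite /ucycle; apply/andP; split.
    move: cyc'; rewrite /= !rcons_path !cat_path last_rcons /= => /and3P[-> ].
    by move=> /and3P[-> -> _] _; rewrite edge_sym uw.
  by move: us2; rewrite -cat_rcons -!cat_cons cat_uniq => /and3P[].
rewrite szs /= ?size_cat ?size_rcons /= ?size_cat /=; clear; lia.
Qed.

Lemma free_choosable_shortest_cycle (G : sgraph) g a b c :
  has_cycle G g -> (forall k, has_cycle G k -> g <= k) ->
  free_choosable G a b c -> free_choosable (cycle_graph g) a b c.
Proof.
move=> [s [ucyc szs s3]] short free L La Lc i0 C CL Cb.
have /andP[cyc us] := ucyc.
case: g szs short L La Lc i0 CL => [szs|n szs short L La Lc i0 CL]; first by rewrite szs in s3.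
have [x0 x0s] : exists x, x \in s by case: (s) s3 => // x t _; exists x; rewrite mem_head.
have next_ordS (i : 'I_n.+1) : nth x0 s (ordS i) = next s (nth x0 s i).
  rewrite next_nth mem_nth ?szs //.
  case: (s) us szs => // y s' us [szs]; rewrite index_uniq ?szs //= ?szs //.
  case: i => i /=; rewrite ltnS leq_eqVlt => /orP[/eqP ->|lt_in].
    (* At the last index [next_nth] reads past the end of [s'] and returns its default [y], the head
       of the cycle. *)
    by rewrite modnn [RHS]nth_default ?szs.
  by rewrite modn_small ?ltnS //=; apply: set_nth_default; rewrite szs.
pose ind u : 'I_n.+1 := inord (index u s).
have indK u : u \in s -> nth x0 s (ind u) = u.
  by move=> us'; rewrite /ind inordK ?nth_index // -szs index_mem.
have nthK (i : 'I_n.+1) : ind (nth x0 s i) = i.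
  by apply/val_inj; rewrite /= inordK index_uniq ?szs.
pose U := \bigcup_(i <- enum 'I_n.+1) L i.
have [F [Fa FU FF]] := fresh_family U a.
have FL i j : fdisjoint (F j) (L i).
  apply: fdisjointWr (FU j); apply/fsubsetP => x xL.
  by apply/bigfcupP; exists i; rewrite ?mem_enum.
(* Lists off the cycle are disjoint from each other and from those on it. Only edges inside [s] can
   be critical, and without chords these are the edges of the cycle. *)
pose L' u := if u \in s then L (ind u) else F (enum_rank u).
have L'a : list_assignment a L' by move=> u; rewrite /L'; case: ifP.
have L'next u w : u \in s -> edge u w -> w = next s u -> #|` L' u `&` L' w| <= c.
  move=> us' uw wE; have ws : w \in s by rewrite wE mem_next.
  rewrite /L' us' ws; apply: Lc.
  have -> : ind w = ordS (ind u) by rewrite wE -{1}(indK u us') -next_ordS nthK.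
  apply/andP; split; last by rewrite eqxx.
  apply/eqP => e; move: (edge_neq uw).
  by rewrite wE -{2}(indK u us') -next_ordS -e indK // eqxx.
have L'c : separating c L'.
  move=> u w uw; have [us'|us'] := boolP (u \in s); have [ws|ws] := boolP (w \in s).
  - have [|wE|uE] := @shortest_cycle_chordless G s u w ucyc _ us' ws uw.
    + by move=> k /short; rewrite szs.
    + exact: L'next.
    + by rewrite fsetIC; apply: L'next; rewrite // edge_sym.
  - rewrite /L' us' (negPf ws); have := FL (ind u) (enum_rank w).
    by rewrite fdisjoint_sym => /eqP ->; rewrite cardfs0.
  - rewrite /L' ws (negPf us'); have := FL (ind w) (enum_rank u).
    by move=> /eqP ->; rewrite cardfs0.
  - rewrite /L' (negPf ws) (negPf us'); have /eqP -> : fdisjoint (F (enum_rank u)) (F (enum_rank w)).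
      by apply: FF; rewrite (inj_eq val_inj) (inj_eq enum_rank_inj) edge_neq.
    by rewrite cardfs0.
have L'nth (i : 'I_n.+1) : L' (nth x0 s i) = L i.
  by rewrite /L' mem_nth ?szs // nthK.
have CL' : C `<=` L' (nth x0 s i0) by rewrite L'nth.
have [phi [[phiL phid] phi0]] := free L' L'a L'c (nth x0 s i0) C CL' Cb.
exists (fun i : cycle_graph n.+1 => phi (nth x0 s i)); split => //; split.
  by move=> i; have := phiL (nth x0 s i); rewrite L'nth.
have dnext (i : 'I_n.+1) : (phi (nth x0 s i) `&` phi (nth x0 s (ordS i)))%fset = fset0 :> {fset int}.
  by apply: phid; rewrite next_ordS; apply: next_cycle cyc _; rewrite mem_nth ?szs.
by move=> i j /andP[_ /orP[]/eqP ->]; rewrite ?[(_ `&` phi (nth x0 s j))%fset]fsetIC; apply: dnext.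
Qed.

End Colouring.

(** * The two inequalities *)

Lemma outerplanar_K23_free (R : realType) (G : sgraph) : outerplanar R G -> K23_free G.
Proof.
by move=> [D out] z z' p q pq dis; apply: (outerplanar_drawing_no_K23 out pq dis).
Qed.

Lemma fsep_le (R : realType) (G H : sgraph) (a b : nat) :
  (forall c, free_choosable G a b c -> free_choosable H a b c) ->
  (fsep R G a b <= fsep R H a b)%E.
Proof.
by move=> GH; apply: ereal_sup_le => _ [c /= Gc <-]; exists c => //=; apply: GH.
Qed.

Theorem theorem4 (R : realType) (G : sgraph) (g a b : nat)
    (Gout : outerplanar R G) (Ggirth : is_girth G g) (g5 : (5 <= g)%N)
    (b1 : (1 <= b)%N) (ab : (b <= a)%N) :
  (fsep R (cycle_graph g.-1) a b <= fsep R G a b)%E /\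
  (fsep R G a b <= fsep R (cycle_graph g) a b)%E.
Proof.
have [Gg short] := Ggirth; split; apply: fsep_le => c.
  exact: free_choosable_K23_free (outerplanar_K23_free Gout) short g5 ab.
exact: free_choosable_shortest_cycle Gg short.
Qed.
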